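(* Let $X:=[-1,1]^d$ and let $P$ be a probability measure on $X\times\{-1,1\}$ with fixed version $\eta\colon X\to[0,1]$ of its posterior probability. Assume that the associated distance to the decision boundary $\Delta_\eta$ controls the noise from below by the exponent $\gamma\in[0,\infty)$ (with constant $c_{\mathrm{LC}}$), and that $P$ has margin-noise exponent (MNE) $\beta\in(0,\infty]$ (with constant $c_{\mathrm{MNE}}$) and margin exponent (ME) $\alpha\in(0,\infty]$ (with constant $c_{\mathrm{ME}}$). Furthermore, let $X_0=\partial_XX_1=\partial_XX_{-1}$ with $\mathcal H^{d-1}(X_0)>0$ and let $X_0$ be $(d-1)$-rectifiable. Let $L$ be the classification loss and $\tau\ge1$. Assume $\beta\le\gamma^{-1}\kappa$, where $\kappa:=(1+\gamma)(\alpha+\gamma)$. In addition, assume that the side length of the cubes is given by $$s_n=\tilde c_{\alpha,\beta,\gamma,\tau,d}\;n^{-\frac{\kappa}{\beta(\kappa+\gamma^2)+d\kappa}},$$ where $$\tilde c_{\alpha,\beta,\gamma,\tau,d}:=\left(\frac{d\cdot\kappa\cdot c_{\alpha,\gamma,d}\cdot\tau^{\frac{(1+\gamma)(\alpha+\gamma)}{\kappa+\gamma^2}}}{6\beta c_{\mathrm{MNE}}^\beta(\kappa+\gamma^2)}\right)^{\frac{\kappa+\gamma^2}{\beta(\kappa+\gamma^2)+d\kappa}}$$ and $c_{\alpha,\gamma,d}$ is the constant given in the context. Then there exists a constant $c_{\alpha,\beta,\gamma,\tau,d}>0$ such that for all $n\ge n_0$ $$\mathcal R_{L,P}(h_{D,s_n})-\mathcal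 R^*_{L,P}\le c_{\alpha,\beta,\gamma,\tau,d}\;n^{-\frac{\beta\kappa}{\beta(\kappa+\gamma^2)+d\kappa}}$$ holds with probability $P^n\ge1-2e^{-\tau}$, where $n_0$ and the constant $c_{\alpha,\beta,\gamma,\tau,d}$ only depend on $\tau,\alpha,\beta,\gamma$ and $d$.
   Context: **Data, loss, risks.** $Y:=\{-1,1\}$; $D=((x_1,y_1),\dots,(x_n,y_n))$ is drawn i.i.d. from $P$, and $P^n$ is the product measure. The classification loss is $L(y,t):=\mathbf 1_{(-\infty,0]}(y\cdot\operatorname{sign}t)$ for $y\in Y$, $t\in\mathbb R$, with $\operatorname{sign}t=1$ for $t\ge0$ and $-1$ for $t<0$. For measurable $f\colon X\to\mathbb R$, $\mathcal R_{L,P}(f):=\int_{X\times Y}L(y,f(x))\,dP(x,y)$, and $\mathcal R^*_{L,P}:=\inf_{f\colon X\to\mathbb R}\mathcal R_{L,P}(f)$ (over measurable $f$) is the Bayes risk. **Histogram rule.** For $s\in(0,1]$ let $\mathcal A=(A_j)_{j\ge1}$ be a partition of $\mathbb R^d$ into cubes of side length $s$; for $x\in X$ let $A(x)$ be the unique cell with $x\in A(x)$. Put $f_{D,s}(x):=\frac1n\sum_{i=1}^n\mathbf 1_{\{y_i=1\}}\mathbf 1_{A(x)}(x_i)-\frac1n\sum_{i=1}^n\mathbf 1_{\{y_i=-1\}}\mathbf 1_{A(x)}(x_i)$. The empirical histogram rule is $h_{D,s}:=\operatorname{sign}f_{D,s}$. **Posterior probability and decision boundary.** $P_X$ is the marginal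 distribution of $P$ on $X$; $\eta(x)=P(y=1|x)$. $X_1:=\{x\in X:\eta(x)>1/2\}$, $X_{-1}:=\{x\in X:\eta(x)<1/2\}$, $X_0:=\{x\in X:\eta(x)=1/2\}$. $\partial_XT$ is the relative boundary of $T$ in $X$. The distance to the decision boundary $\Delta_\eta\colon X\to[0,\infty]$ is $\Delta_\eta(x):=d(x,X_1)$ if $x\in X_{-1}$, $\Delta_\eta(x):=d(x,X_{-1})$ if $x\in X_1$, and $\Delta_\eta(x):=0$ otherwise, where $d(x,A):=\inf_{x'\in A}d(x,x')$ and $d(x,x')=\|x-x'\|_\infty$. **Exponents.** $P$ has ME $\alpha\in(0,\infty]$ if there is a constant $c_{\mathrm{ME}}>0$ with $P_X(\{\Delta_\eta(x)<t\})\le(c_{\mathrm{ME}}t)^\alpha$ for all $t>0$. $P$ has MNE $\beta\in(0,\infty]$ if there is a constant $c_{\mathrm{MNE}}>0$ with $\int_{\{\Delta_\eta<t\}}|2\eta(x)-1|\,dP_X(x)\le(c_{\mathrm{MNE}}t)^\beta$ for all $t>0$. $\Delta_\eta$ controls the noise from below by the exponent $\gamma\in[0,\infty)$ if there is a constant $c_{\mathrm{LC}}>0$ with $\Delta_\eta^\gamma(x)\le c_{\mathrm{LC}}|2\eta(x)-1|$ for $P_X$-almost all $x\in X$. **Geometry.** $\mathcal H^{d-1}$ is the $(d-1)$-dimensional Hausdorff measure on $\mathbb R^d$. A set $T\subset X$ is $m$-rectifiable for an integer $m>0$ if there is a Lipschitz function mapping some bounded subset of $\mathbb R^m$ onto $T$.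 **Constants.** $$\hat c:=32\max\{12\,\mathcal H^{d-1}(\{\eta=1/2\}),1\}\cdot\max\Big\{1,\tfrac{\alpha+\gamma}{\gamma}\,c_{\mathrm{ME}}^{\frac{\alpha\gamma}{\alpha+\gamma}}\big(\tfrac{\gamma c_{\mathrm{LC}}}{\alpha}\big)^{\frac{\alpha}{\alpha+\gamma}}\Big\},$$ $$\tilde c_{\alpha,\gamma,d}:=\left(\frac{16\gamma(\alpha+2\gamma)\cdot8^{d+1}\max\{c_{\mathrm{LC}},2^\gamma\}\cdot(\alpha+\gamma)^{-1}}{\hat c^{\frac{\alpha+\gamma}{\alpha+2\gamma}}}\right)^{\frac{\alpha+\gamma}{\alpha+\gamma+\gamma(\alpha+2\gamma)}},$$ $$c_{\alpha,\gamma,d}:=128\cdot8^{d+1}\max\{c_{\mathrm{LC}},2^\gamma\}\cdot\max\Big\{\tfrac{\gamma(\alpha+2\gamma)}{\alpha+\gamma},1\Big\}\cdot\tilde c_{\alpha,\gamma,d}^{\,-\gamma}.$$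
   Formalization: The constant c may also depend on c_ME, c_MNE, c_LC and H^{d-1}(X_0), and n_0 additionally on the set X_0 (but not otherwise on P or η); with dependence on τ, α, β, γ, d alone the claim is false. *)

(* Defs.v *)
From HB Require Import structures.
From mathcomp Require Import all_boot all_order all_algebra.
From mathcomp Require Import all_classical all_reals all_analysis.
Set Implicit Arguments.
Unset Strict Implicit.
Unset Printing Implicit Defensive.
Import Order.TTheory GRing.Theory Num.Theory numFieldNormedType.Exports.
Local Open Scope classical_set_scope.
Local Open Scope ring_scope.

(* R^d with its Borel sigma-algebra; its norm `|x| is the maximum norm. *)
Notation Rd R d := (g_sigma_algebraType (@open 'rV[R]_d)).

(* The label set {-1, 1} is encoded by bool, see [label]. *)
Notation XY R d := (Rd R d * bool)%type.

Definition label (R : realType) (b : bool) : R := if b then 1 else - 1.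

Definition cubeX (R : realType) (d : nat) : set (Rd R d) :=
  [set x | forall i, -1 <= (x : 'rV[R]_d) ord0 i <= 1].
Arguments cubeX : clear implicits.

(* Probability measures on R^d x {-1, 1} that live on X x {-1, 1}. *)
Definition on_cubeX (R : realType) (d : nat)
    (P : probability (XY R d) R) : Prop :=
  P (cubeX R d `*` [set: bool]) = 1%E.

Definition input (R : realType) (d : nat) (z : XY R d) : Rd R d := z.1.

Lemma measurable_input (R : realType) (d : nat) :
  measurable_fun setT (@input R d).
Proof. exact: measurable_fst. Qed.

HB.instance Definition _ (R : realType) (d : nat) :=
  isMeasurableFun.Build _ _ _ _ (@input R d) (@measurable_input R d).

Definition marginal (R : realType) (d : nat) (P : probability (XY R d) R) :
    probability (Rd R d) R :=
  distribution P (@input R d).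

Section product_power.
Context (R : realType) (dsp : measure_display) (T : measurableType dsp).

Definition tuple_cons (n : nat) (z : T * n.-tuple T) : n.+1.-tuple T :=
  [tuple of z.1 :: z.2].

Lemma measurable_tuple_cons n : measurable_fun setT (@tuple_cons n).
Proof. exact: (measurable_cons measurable_fst measurable_snd). Qed.

HB.instance Definition _ n := isMeasurableFun.Build _ _ _ _ (@tuple_cons n)
  (@measurable_tuple_cons n).

Fixpoint prob_power (P : probability T R) (n : nat) :
    probability (n.-tuple T) R :=
  match n with
  | 0 => \d_ ([tuple] : 0.-tuple T)
  | m.+1 => distribution (P \x prob_power P m)%E (@tuple_cons m)
  end.
End product_power.

Definition sgn (R : realType) (t : R) : R := if 0 <= t then 1 else -1.

Definition class_loss (R : realType) (y t : R) : R :=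
  \1_[set u : R | u <= 0] (y * sgn t).

Definition risk (R : realType) (d : nat) (P : probability (XY R d) R)
    (f : Rd R d -> R) : \bar R :=
  (\int[P]_(z in cubeX R d `*` [set: bool])
     (class_loss (label R z.2) (f z.1))%:E)%E.

Definition bayes_risk (R : realType) (d : nat) (P : probability (XY R d) R) :
    \bar R :=
  ereal_inf [set risk P f | f in [set f | measurable_fun (cubeX R d) f]].

(* A cube is a product of intervals [a_i, a_i + s[ or ]a_i, a_i + s]. *)
Definition is_cube (R : realType) (d : nat) (s : R) (A : set 'rV[R]_d) : Prop :=
  exists (a : 'rV[R]_d) (b : 'I_d -> bool),
    A = [set x | forall i, x ord0 i \in
          Interval (BSide (b i) (a ord0 i)) (BSide (b i) (a ord0 i + s))].

Definition cube_partition (R : realType) (d : nat) (s : R)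
    (A : nat -> set 'rV[R]_d) : Prop :=
  [/\ trivIset setT A, \bigcup_j A j = setT & forall j, is_cube s (A j)].

Definition cell (R : realType) (d : nat) (A : nat -> set 'rV[R]_d)
    (x : 'rV[R]_d) : set 'rV[R]_d :=
  \bigcup_(j in [set j | A j x]) A j.

Definition hist_score (R : realType) (d n : nat) (A : nat -> set 'rV[R]_d)
    (D : n.-tuple (XY R d)) (x : Rd R d) : R :=
  n%:R^-1 * (\sum_(i < n) (label R (tnth D i).2 == 1)%:R *
                          \1_(cell A x) (tnth D i).1) -
  n%:R^-1 * (\sum_(i < n) (label R (tnth D i).2 == -1)%:R *
                          \1_(cell A x) (tnth D i).1).

Definition hist_rule (R : realType) (d n : nat) (A : nat -> set 'rV[R]_d)
    (D : n.-tuple (XY R d)) (x : Rd R d) : R :=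
  sgn (hist_score A D x).

(* eta is a version of x |-> P(y = 1 | x); only its values on X matter. *)
Definition is_posterior (R : realType) (d : nat) (P : probability (XY R d) R)
    (eta : Rd R d -> R) : Prop :=
  [/\ measurable_fun (cubeX R d) eta,
      forall x, cubeX R d x -> 0 <= eta x <= 1 &
      forall B, measurable B -> B `<=` cubeX R d ->
        P (B `*` [set true]) = (\int[marginal P]_(x in B) (eta x)%:E)%E].

Definition Xpos (R : realType) (d : nat) (eta : Rd R d -> R) : set (Rd R d) :=
  [set x | cubeX R d x /\ 1 / 2 < eta x].
Definition Xneg (R : realType) (d : nat) (eta : Rd R d -> R) : set (Rd R d) :=
  [set x | cubeX R d x /\ eta x < 1 / 2].
Definition Xzero (R : realType) (d : nat) (eta : Rd R d -> R) : set (Rd R d) :=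
  [set x | cubeX R d x /\ eta x = 1 / 2].

Definition rel_boundary (R : realType) (d : nat) (X T : set 'rV[R]_d) :
    set 'rV[R]_d :=
  X `&` closure (X `&` T) `&` closure (X `\` T).

Definition set_dist (R : realType) (d : nat) (x : 'rV[R]_d)
    (A : set 'rV[R]_d) : \bar R :=
  ereal_inf [set `|x - x'|%:E | x' in A].

Definition Delta (R : realType) (d : nat) (eta : Rd R d -> R) (x : Rd R d) :
    \bar R :=
  if x \in Xneg eta then set_dist x (Xpos eta)
  else if x \in Xpos eta then set_dist x (Xneg eta)
  else 0%E.

(* x to the power a, for x >= 0 and a in (0, +oo] *)
Definition powRe (R : realType) (x : R) (a : \bar R) : \bar R :=
  match a with
  | a%:E => (x `^ a)%:E
  | _ => if x < 1 then 0%E else if x == 1 then 1%E else +oo%E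
  end.

Definition has_ME (R : realType) (d : nat) (P : probability (XY R d) R)
    (eta : Rd R d -> R) (alpha : \bar R) (cME : R) : Prop :=
  forall t : R, 0 < t ->
    (marginal P [set x | cubeX R d x /\ (Delta eta x < t%:E)%E]
       <= powRe (cME * t) alpha)%E.

Definition has_MNE (R : realType) (d : nat) (P : probability (XY R d) R)
    (eta : Rd R d -> R) (beta : \bar R) (cMNE : R) : Prop :=
  forall t : R, 0 < t ->
    (\int[marginal P]_(x in [set x | cubeX R d x /\ Delta eta x < t%:E])
       `|2 * eta x - 1|%:E <= powRe (cMNE * t) beta)%E.

Definition controls_noise_below (R : realType) (d : nat)
    (P : probability (XY R d) R) (eta : Rd R d -> R) (gamma cLC : R) : Prop :=
  {ae marginal P, forall x, cubeX R d x ->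
     (Delta eta x `^ gamma <= (cLC * `|2 * eta x - 1|)%:E)%E}.

Definition eucl_dist (R : realType) (d : nat) (x y : 'rV[R]_d) : R :=
  Num.sqrt (\sum_i (x ord0 i - y ord0 i) ^+ 2).

Definition diam (R : realType) (d : nat) (U : set 'rV[R]_d) : \bar R :=
  ereal_sup (0%E |` [set (eucl_dist x y)%:E | x in U & y in U]).

(* Volume of the Euclidean unit ball of R^m. *)
Fixpoint ball_volume (R : realType) (m : nat) : R :=
  match m with
  | 0 => 1
  | 1 => 2
  | m'.+2 => 2 * pi / m%:R * ball_volume R m'
  end.

Definition hausdorff_content (R : realType) (d m : nat) (delta : R)
    (A : set 'rV[R]_d) : \bar R :=
  ereal_inf [set (\sum_(0 <= k <oo)
                    ((ball_volume R m / 2 ^+ m)%:E * diam (U k) ^+ m))%E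
            | U in [set U : nat -> set 'rV[R]_d |
                     A `<=` \bigcup_k U k /\
                     forall k, (diam (U k) <= delta%:E)%E]].

(* m-dimensional Hausdorff measure for m > 0, normalized as Lebesgue measure on
   m-planes (for m = 0 empty covering sets would be counted). *)
Definition hausdorff (R : realType) (d m : nat) (A : set 'rV[R]_d) : \bar R :=
  ereal_sup [set hausdorff_content m delta A | delta in [set e : R | 0 < e]].

Definition rectifiable (R : realType) (d m : nat) (T : set 'rV[R]_d) : Prop :=
  (0 < m)%N /\
  exists (B : set 'rV[R]_m) (f : 'rV[R]_m -> 'rV[R]_d),
    [/\ bounded_set B, [lipschitz f x | x in B] & f @` B = T].

(* The exponents alpha and beta range over (0, +oo]. Below, the branches
   alpha = a%:E and beta = b%:E carry the closed formulas; the other branches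
   are the limits of these formulas as a -> +oo and b -> +oo. The argument
   h stands for the (d-1)-dimensional Hausdorff measure of {eta = 1/2}. *)

Definition kappa (R : realType) (alpha : \bar R) (gamma : R) : \bar R :=
  ((1 + gamma)%:E * (alpha + gamma%:E))%E.

(* For gamma = 0 the quotient by gamma is junk, but then c_hat only occurs in
   the power c_tilde `^ (- 0) = 1. *)
Definition c_hat (R : realType) (alpha : \bar R) (gamma cME cLC h : R) : R :=
  32 * Num.max (12 * h) 1 *
  Num.max 1
    match alpha with
    | a%:E => (a + gamma) / gamma * cME `^ (a * gamma / (a + gamma)) *
              (gamma * cLC / a) `^ (a / (a + gamma))
    | _ => cME `^ gamma * cLC
    end.

Definition c_tilde (R : realType) (d : nat) (alpha : \bar R)
    (gamma cME cLC h : R) : R :=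
  let M := 8 ^+ d.+1 * Num.max cLC (2 `^ gamma) in
  let ch := c_hat alpha gamma cME cLC h in
  match alpha with
  | a%:E =>
      (16 * gamma * (a + 2 * gamma) * M * (a + gamma)^-1 /
       ch `^ ((a + gamma) / (a + 2 * gamma)))
      `^ ((a + gamma) / (a + gamma + gamma * (a + 2 * gamma)))
  | _ => (16 * gamma * M / ch) `^ (1 + gamma)^-1
  end.

Definition c_agd (R : realType) (d : nat) (alpha : \bar R)
    (gamma cME cLC h : R) : R :=
  128 * 8 ^+ d.+1 * Num.max cLC (2 `^ gamma) *
  Num.max
    match alpha with
    | a%:E => gamma * (a + 2 * gamma) / (a + gamma)
    | _ => gamma
    end 1 *
  c_tilde d alpha gamma cME cLC h `^ (- gamma).

(* kappa / (beta (kappa + gamma^2) + d kappa) *)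
Definition side_exponent (R : realType) (d : nat) (alpha beta : \bar R)
    (gamma : R) : R :=
  match alpha, beta with
  | a%:E, b%:E =>
      let k := (1 + gamma) * (a + gamma) in
      k / (b * (k + gamma ^+ 2) + d%:R * k)
  | _, b%:E => (b + d%:R)^-1
  | _, _ => 0
  end.

(* beta kappa / (beta (kappa + gamma^2) + d kappa) *)
Definition rate_exponent (R : realType) (d : nat) (alpha beta : \bar R)
    (gamma : R) : R :=
  match alpha, beta with
  | a%:E, b%:E =>
      let k := (1 + gamma) * (a + gamma) in
      b * k / (b * (k + gamma ^+ 2) + d%:R * k)
  | _, b%:E => b / (b + d%:R)
  | a%:E, _ =>
      let k := (1 + gamma) * (a + gamma) in k / (k + gamma ^+ 2)
  | _, _ => 1
  end.

Definition c_side (R : realType) (d : nat) (alpha beta : \bar R)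
    (gamma tau cME cMNE cLC h : R) : R :=
  let c := c_agd d alpha gamma cME cLC h in
  match alpha, beta with
  | a%:E, b%:E =>
      let k := (1 + gamma) * (a + gamma) in
      (d%:R * k * c * tau `^ ((1 + gamma) * (a + gamma) / (k + gamma ^+ 2)) /
       (6 * b * cMNE `^ b * (k + gamma ^+ 2)))
      `^ ((k + gamma ^+ 2) / (b * (k + gamma ^+ 2) + d%:R * k))
  | _, b%:E =>
      (d%:R * c * tau / (6 * b * cMNE `^ b)) `^ (b + d%:R)^-1
  | _, _ => cMNE^-1
  end.

Definition side (R : realType) (d : nat) (alpha beta : \bar R)
    (gamma tau cME cMNE cLC h : R) (n : nat) : R :=
  c_side d alpha beta gamma tau cME cMNE cLC h *
  n%:R `^ (- side_exponent d alpha beta gamma).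

(* Main.v *)
Require Import Defs.
From HB Require Import structures.
From mathcomp Require Import all_boot all_order all_algebra.
From mathcomp Require Import all_classical all_reals all_analysis.
From mathcomp Require Import measurable_realfun.
From mathcomp Require Import zify ring lra.
Import Order.TTheory GRing.Theory Num.Theory numFieldNormedType.Exports.
Set Implicit Arguments.
Unset Strict Implicit.
Unset Printing Implicit Defensive.
Local Open Scope classical_set_scope.
Local Open Scope ring_scope.

(* The excess risk of the histogram rule is the integral of |2 eta - 1| over the
   misclassified points.  Points with Delta < s contribute at most
   (cMNE s)^beta by the margin-noise exponent, whatever the rule does there.
   A cell containing a point with Delta >= s lies on one side of the decision
   boundary, and a Chernoff bound shows that it is misclassified with
   probability at most 4 q / (n m^2), where q is its mass and m its integral of
   |2 eta - 1|.  Hence its expected loss is at most 4 / (n rho) if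
   |2 eta - 1| >= rho on it, and at most lam q + 4 / (n lam) for any lam > 0.
   Since the constant may depend on tau, Markov's inequality applied to the sum
   of these losses suffices.

   If gamma = 0 or alpha = oo, then |2 eta - 1| is bounded below almost
   everywhere and counting the cells of X gives the rate.  Otherwise the far
   cells are split at two distances s <= t1, t2.  Beyond t2 all cells are
   counted; between t1 and t2 the boundary has at most K t2 s^-d cells nearby,
   as X0 is a Lipschitz image of a bounded set of dimension d - 1; below t1 the
   margin exponent bounds the mass.  The exponents of t1 and t2 leave strict
   room, so the factor K, which depends on X0, is absorbed for n >= n0. *)

(** The constant [c] must not depend on the boundary, whereas the count of cells near it carries the
    factor K. Hence every layer counted with K must beat the rate by a positive power of n, and this
    dictates the exponents. Write sg, r for the exponents of side and rate, F = b (k + g^2) + d k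
    for their denominator, and t1 = n^-x, t2 = n^-y up to constants. The outer layer costs s^-d / (n
    t2^g); equating this with n^-r gives g y = 1 - d sg - r, that is y = b g / F, and t2 >= s then
    amounts to beta gamma <= kappa. The middle layer costs K t2 s^-d / (n t1^g), which beats n^-r if
    x F < b (1 + g). The inner layer costs lam t1^a + K t1 s^-d / (n lam). With lam t1^a = n^-r, its
    second term beats n^-r if x F > b (1 + g - 1/(1 + a)). The two conditions on x are compatible,
    with strict room. If they ask for t1 below s, then t1 is taken of the order of s and the
    margin-noise exponent handles the inner layer. *)

(** * Concentration of label counts under the product measure *)

Section prob_power.
Context (R : realType) (dsp : measure_display) (T : measurableType dsp).
Implicit Types (P : probability T R) (n : nat).

Lemma measurable_prod_tnth n (phi : T -> R) : measurable_fun setT phi ->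
  measurable_fun setT (fun D : n.-tuple T => \prod_(i < n) phi (tnth D i)).
Proof.
move=> mphi; apply: measurable_prod => i _.
exact: (measurableT_comp mphi (measurable_tnth i)).
Qed.

(** Independence of the sample points: Tonelli splits off the first coordinate, and the inner
    integral is the induction hypothesis. *)
Lemma integral_prob_power_prod P n (phi : T -> R) (v : R) :
  measurable_fun setT phi -> (forall z, 0 <= phi z) ->
  (\int[P]_z (phi z)%:E = v%:E)%E ->
  (\int[prob_power P n]_D (\prod_(i < n) phi (tnth D i))%:E = (v ^+ n)%:E)%E.
Proof.
move=> mphi phi0 phiv; elim: n => [|n IHn].
  under eq_integral do rewrite big_ord0.
  by rewrite integral_cst//= probability_setT mul1e.
rewrite /= /distribution ge0_integral_pushforward//=; first last.
- by move=> D _; rewrite lee_fin prodr_ge0.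
- by apply/measurable_EFinP; exact: measurable_prod_tnth.
rewrite preimage_setT; under eq_integral.
  move=> z _; rewrite big_ord_recl tnth0.
  under eq_bigr => i _ do rewrite tnthS /=.
  over.
rewrite fubini_tonelli1 /=; first last.
- by move=> z; rewrite lee_fin mulr_ge0// prodr_ge0.
- apply/measurable_EFinP; apply: measurable_funM.
    exact: (measurableT_comp mphi measurable_fst).
  exact: (measurableT_comp (measurable_prod_tnth mphi) measurable_snd).
rewrite /fubini_F /=; under eq_integral.
  move=> x _; under eq_integral do rewrite EFinM.
  rewrite ge0_integralZl_EFin//=; first last.
  - by apply/measurable_EFinP; exact: measurable_prod_tnth.
  - by move=> D _; rewrite lee_fin prodr_ge0.
  rewrite IHn muleC.
  over.
have v0 : 0 <= v.
  by rewrite -lee_fin -phiv integral_ge0// => x _; rewrite lee_fin.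
rewrite ge0_integralZl_EFin//=.
- by rewrite phiv -EFinM exprSr.
- by move=> x _; rewrite lee_fin.
- exact/measurable_EFinP.
- exact: exprn_ge0.
Qed.

(** By induction, (1 - x)^n (1 + n x) <= 1. This trades exponential decay for the form 1/(n x),
    which is convenient to sum over cells. *)
Lemma exprn_1sub_le (x : R) n : (0 < n)%N -> 0 < x <= 1 ->
  (1 - x) ^+ n <= (n%:R * x)^-1.
Proof.
move=> n0 /andP[x0 x1].
have nx0 : 0 < n%:R * x by rewrite mulr_gt0// ltr0n.
rewrite -[leRHS]mul1r ler_pdivlMr//.
suff : (1 - x) ^+ n * (1 + n%:R * x) <= 1.
  have : 0 <= (1 - x) ^+ n by rewrite exprn_ge0// subr_ge0.
  nra.
elim: {n0 nx0} n => [|n IHn]; first by rewrite expr0 mul0r addr0 mulr1.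
apply: le_trans IHn; rewrite exprSr -mulrA ler_wpM2l ?exprn_ge0 ?subr_ge0//.
have : 0 <= n%:R :> R by [].
rewrite -natr1; nra.
Qed.

Lemma measurable_sum_indic n (U : set T) : measurable U ->
  measurable_fun setT (fun D : n.-tuple T => \sum_(i < n) \1_U (tnth D i) : R).
Proof.
move=> mU; apply: measurable_sum => i.
have mI : measurable_fun setT (\1_U : T -> R) by exact: measurable_indic.
exact: (measurableT_comp mI (measurable_tnth i)).
Qed.

Lemma measurable_count_le n (U V : set T) : measurable U -> measurable V ->
  measurable [set D : n.-tuple T |
    \sum_(i < n) \1_U (tnth D i) <= \sum_(i < n) \1_V (tnth D i) :> R].
Proof.
move=> mU mV; rewrite -[X in measurable X]setTI.
exact: (measurable_fun_ler (measurable_sum_indic mU) (measurable_sum_indic mV)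
  measurableT (Y := [set true])).
Qed.

Lemma expr_count n (U : set T) (D : n.-tuple T) (w : R) :
  w ^+ (\sum_(i < n) (tnth D i \in U))%N =
  \prod_(i < n) w ^+ (tnth D i \in U).
Proof. by rewrite expr_sum. Qed.

(* Chernoff's bound for the product weight [w ^ (#V - #U)], with
   [w = 1 + (p - r) / (2 (p + r))]. *)
Lemma prob_power_count_le P n (U V : set T) (p r : R) :
  measurable U -> measurable V -> U `&` V = set0 -> (0 < n)%N ->
  P U = p%:E -> P V = r%:E -> 0 <= r -> r < p ->
  (prob_power P n [set D | (\sum_(i < n) \1_U (tnth D i) <=
                           \sum_(i < n) \1_V (tnth D i) :> R)%R]
   <= (4 * (p + r) / (n%:R * (p - r) ^+ 2))%:E)%E.
Proof.
move=> mU mV UV n0 PU PV r0 rp.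
have q0 : 0 < p + r by lra.
have m0 : 0 < p - r by lra.
have p1 : p + r <= 1.
  have := probability_le1 P (measurableU _ _ mU mV).
  have -> : P (U `|` V) = (P U + P V)%E by rewrite measureU.
  by rewrite PU PV -EFinD lee_fin.
pose rho := (p - r) / (2 * (p + r)).
have rhoE : rho * (2 * (p + r)) = p - r by rewrite /rho divfK// mulf_neq0// gt_eqF.
have rho0 : 0 < rho by rewrite divr_gt0// mulr_gt0.
pose w := 1 + rho.
have w1 : 1 <= w by rewrite /w; lra.
have w0 : 0 < w by lra.
have wV : w^-1 * w = 1 by rewrite mulVf// gt_eqF.
have wV0 : 0 < w^-1 by rewrite invr_gt0.
have wVle1 : w^-1 <= 1 by rewrite invf_le1.
pose phi z : R := w^-1 ^+ (z \in U) * w ^+ (z \in V).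
(* Disjointness of U and V makes phi affine in the two indicators, so its mean v is explicit. *)
have phiE z : phi z = 1 + (w - 1) * \1_V z - (1 - w^-1) * \1_U z.
  rewrite /phi !indicE; case: (boolP (z \in U)) => zU; case: (boolP (z \in V)) => zV //=.
  - have : (U `&` V) z by split; apply/set_mem.
    by rewrite UV.
  - by rewrite expr1 expr0; ring.
  - by rewrite expr1 expr0; ring.
  - by rewrite !expr0; ring.
have phi0 z : 0 <= phi z by rewrite mulr_ge0// exprn_ge0// ltW.
have mphi : measurable_fun setT phi.
  rewrite (_ : phi = fun z => w^-1 * \1_U z + w * \1_V z + \1_(~` (U `|` V)) z).
    apply: measurable_funD; first apply: measurable_funD.
    - by apply: measurable_funM => //; exact: measurable_indic.
    - by apply: measurable_funM => //; exact: measurable_indic.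
    - by apply: measurable_indic; apply: measurableC; exact: measurableU.
  apply/funext => z; rewrite phiE !indicE in_setC in_setU.
  case: (boolP (z \in U)) => zU; case: (boolP (z \in V)) => zV //=.
  - have : (U `&` V) z by split; apply/set_mem.
    by rewrite UV.
  - by ring.
  - by ring.
  - by ring.
pose v := 1 + (w - 1) * r - (1 - w^-1) * p.
have phiv : (\int[P]_z (phi z)%:E = v%:E)%E.
  (* The negative term is moved to the left, so that only nonnegative functions are integrated. *)
  have : (\int[P]_z (phi z)%:E + \int[P]_z ((1 - w^-1) * \1_U z)%:E =
          \int[P]_z 1%:E + \int[P]_z ((w - 1) * \1_V z)%:E)%E.
    rewrite -!ge0_integralD//=.
    - apply: eq_integral => z _; rewrite -!EFinD phiE; congr EFin; ring.
    - by move=> z _; rewrite lee_fin mulr_ge0// subr_ge0.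
    - apply/measurable_EFinP; apply: measurable_funM => //; exact: measurable_indic.
    - by move=> z _; rewrite lee_fin.
    - exact/measurable_EFinP.
    - by move=> z _; rewrite lee_fin mulr_ge0// subr_ge0.
    - apply/measurable_EFinP; apply: measurable_funM => //; exact: measurable_indic.
  rewrite integral_cst//= probability_setT mule1.
  under [X in (_ + X = _ -> _)%E]eq_integral do rewrite EFinM.
  under [X in (_ = _ + X -> _)%E]eq_integral do rewrite EFinM.
  rewrite !ge0_integralZl_EFin ?subr_ge0//; first last.
  - by apply/measurable_EFinP; exact: measurable_indic.
  - by apply/measurable_EFinP; exact: measurable_indic.
  have -> : (\int[P]_z (\1_U z)%:E = p%:E)%E by rewrite integral_indic// setIT.
  have -> : (\int[P]_z (\1_V z)%:E = r%:E)%E by rewrite integral_indic// setIT.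
  rewrite -!EFinM.
  case: (\int[P]_z _)%E => //= x; rewrite -!EFinD => -[xE]; congr EFin.
  by rewrite /v -xE; ring.
set E := [set D | _].
have mE : measurable E by exact: measurable_count_le.
have EW : (prob_power P n E <= (v ^+ n)%:E)%E.
  rewrite -(integral_prob_power_prod n mphi phi0 phiv) -[E]setIT -integral_indic//.
  apply: ge0_le_integral => //.
  - by apply/measurable_EFinP; exact: measurable_indic.
  - by apply/measurable_EFinP; exact: measurable_prod_tnth.
  move=> D _; rewrite lee_fin indicE; case: (boolP (D \in E)) => [/set_mem|_]; last first.
    by rewrite prodr_ge0.
  rewrite /E /=.
  under eq_bigr do rewrite indicE.
  under [leRHS]eq_bigr do rewrite indicE.
  rewrite -!natr_sum ler_nat => cUV.
  rewrite big_split /= -!expr_count exprVn mulrC ler_pdivlMr ?exprn_gt0// mul1r.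
  exact: ler_weXn2l.
apply: (le_trans EW); rewrite lee_fin.
have x0 : 0 < (p - r) ^+ 2 / (4 * (p + r)) by rewrite divr_gt0// ?exprn_gt0// mulr_gt0.
have v0 : 0 <= v.
  by rewrite -lee_fin -phiv integral_ge0// => z _; rewrite lee_fin.
(* From 1/w >= 1 - rho follows v <= 1 - rho (p - r) + rho^2 p, and rho (p + r) = (p - r)/2 makes the
   quadratic term at most half of the linear one. *)
have vle : v <= 1 - (p - r) ^+ 2 / (4 * (p + r)).
  clear - rhoE rho0 r0 rp q0 m0 w0 wV wV0 wVle1 p1.
  have -> : (p - r) ^+ 2 / (4 * (p + r)) = rho * (p - r) / 2.
    by rewrite /rho; field; rewrite gt_eqF.
  have wVE : 1 - w^-1 = rho * w^-1 by rewrite -{1}wV /w; ring.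
  have w1E : w - 1 = rho by rewrite /w; ring.
  rewrite /v wVE w1E.
  have : 1 - rho <= w^-1.
    by rewrite -[leRHS]mul1r ler_pdivlMr// /w; nra.
  move: (w^-1) wV0 wVle1 => u u0 u1 ur; clearbody rho.
  have : 0 <= rho * p * (u - (1 - rho)) by rewrite !mulr_ge0 ?subr_ge0 ?(ltW rho0)//; lra.
  have : 0 <= rho * (rho * r) by rewrite !mulr_ge0// ltW.
  have : 0 <= rho * (p - r - rho * (2 * (p + r))) by rewrite rhoE subrr mulr0.
  nra.
apply: le_trans (lerXn2r _ _ _ vle) _ => //; first by rewrite nnegrE; exact: le_trans vle.
apply: le_trans (exprn_1sub_le n0 _) _.
  by rewrite x0/= -subr_ge0; exact: le_trans vle.
by rewrite le_eqVlt; apply/orP; left; apply/eqP; field; rewrite !gt_eqF ?ltr0n//.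
Qed.

End prob_power.

(** * Grids, finite nets and the counting of cubes *)

Section grids.
Context (R : realType).
Implicit Types (m d : nat) (e r s t : R).

Lemma norm_rV_lt m (x : 'rV[R]_m) e :
  0 < e -> (forall i, `|x ord0 i| < e) -> `|x| < e.
Proof.
move=> e0 xe; rewrite [ltLHS]/Num.norm /= mx_normrE.
by apply: bigmax_lt => // -[i j] _ /=; rewrite (ord1 i).
Qed.

Lemma coord_le_norm m (x : 'rV[R]_m) i : `|x ord0 i| <= `|x|.
Proof.
rewrite [leRHS]/Num.norm /= mx_normrE.
exact: (le_bigmax _ (fun ij : 'I_1 * 'I_m => `|x ij.1 ij.2|) (ord0, i)).
Qed.

(** The coordinates of x - y, shifted by r, are rounded down to multiples of e. A finite codomain
    turns later counts into cardinalities; on the ball of radius r the index stays in range, so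
    [inord] loses nothing. *)
Lemma grid_index m (y : 'rV[R]_m) r e : 0 < e -> 0 <= r ->
  exists g : 'rV[R]_m -> {ffun 'I_m -> 'I_(Num.trunc (2 * r / e)).+1},
    forall x x', `|x - y| <= r -> `|x' - y| <= r -> g x = g x' ->
    forall i, `|x ord0 i - x' ord0 i| < e.
Proof.
move=> e0 r0.
pose q (x : 'rV[R]_m) i := (x ord0 i - y ord0 i + r) / e.
have qP x i : `|x - y| <= r -> 0 <= q x i /\ q x i <= 2 * r / e.
  move=> xy; have := le_trans (coord_le_norm (x - y) i) xy.
  rewrite !mxE ler_norml => /andP[h1 h2].
  by split; [rewrite divr_ge0 ?(ltW e0)//|rewrite ler_pM2r ?invr_gt0//]; lra.
exists (fun x => [ffun i => inord (Num.trunc (q x i))]) => x x' xy xy' gE i.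
have := congr1 (fun h : {ffun 'I_m -> 'I_(Num.trunc (2 * r / e)).+1} => val (h i)) gE => /=.
have [q0 q1] := qP x i xy; have [q0' q1'] := qP x' i xy'.
rewrite !ffunE !inordK ?ltnS ?le_truncn// => tE.
have /andP[l1 l2] := truncn_itv q0; have /andP[] := truncn_itv q0'.
rewrite -tE => l1' l2'.
have -> : x ord0 i - x' ord0 i = (q x i - q x' i) * e.
  by rewrite /q; field; rewrite gt_eqF.
rewrite normrM (gtr0_norm e0) gtr_pMl// ltr_norml.
by move: l2 l2'; rewrite -natr1; lra.
Qed.

Lemma card_grid_le m e r : 0 < e -> 0 <= r ->
  (((Num.trunc (2 * r / e)).+1 ^ m)%N)%:R <= (2 * r / e + 1) ^+ m.
Proof.
move=> e0 r0; rewrite natrX lerXn2r ?nnegrE// ?addr_ge0 ?divr_ge0 ?mulr_ge0 ?(ltW e0)//.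
by rewrite -natr1 lerD2r truncn_le divr_ge0 ?mulr_ge0 ?(ltW e0).
Qed.

(** One representative is chosen from each grid class that meets B. The net must lie in B because
    the Lipschitz bound it serves holds on B only. *)
Lemma bounded_net m (B : set 'rV[R]_m) r e : 0 < e -> 0 <= r ->
  (forall b, B b -> `|b| <= r) ->
  exists bs : seq 'rV[R]_m,
    [/\ (size bs)%:R <= (2 * r / e + 1) ^+ m, {in bs, forall b, B b} &
        forall b, B b -> exists2 b', b' \in bs & `|b - b'| < e].
Proof.
move=> e0 r0 Br; have [g gP] := grid_index (0 : 'rV[R]_m) e0 r0.
pose rep k : option 'rV[R]_m :=
  if pselect (exists b, B b /\ g b = k) is left ex then Some (projT1 (cid ex)) else None.
exists (pmap rep (enum {ffun 'I_m -> 'I_(Num.trunc (2 * r / e)).+1})); split.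
- apply: le_trans (card_grid_le m e0 r0); rewrite ler_nat size_pmap.
  apply: leq_trans (count_size _ _) _.
  by rewrite -cardE card_ffun !card_ord.
- move=> b; rewrite mem_pmap => /mapP[k _]; rewrite /rep.
  by case: pselect => // ex [->]; case: (projT2 (cid ex)).
- move=> b Bb; have repE : exists2 b', rep (g b) = Some b' & B b' /\ g b' = g b.
    rewrite /rep; case: pselect => [ex|[]]; last by exists b.
    by exists (projT1 (cid ex)) => //; exact: projT2 (cid ex).
  have [b' repb [Bb' gb']] := repE; exists b'.
    by rewrite mem_pmap; apply/mapP; exists (g b); rewrite ?mem_enum ?repb.
  apply: norm_rV_lt => // i; rewrite !mxE; apply: gP; rewrite ?subr0 ?gb'//; exact: Br.
Qed.

Lemma is_cube_lattice d s (A : set 'rV[R]_d) : 0 < s -> is_cube s A ->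
  exists k : 'I_d -> int, A (\row_i (s * (k i)%:~R)).
Proof.
move=> s0 [a [b ->]].
(* A half-open interval of length s contains a multiple of s: the first one at or after the left end
   if that end is included, the first one strictly after it otherwise. *)
exists (fun i => if b i then Num.ceil (a ord0 i / s) else Num.floor (a ord0 i / s) + 1).
move=> i /=; rewrite mxE; set t := a ord0 i / s.
have aE : a ord0 i = s * t by rewrite /t mulrC divfK// gt_eqF.
rewrite aE; case: (b i); rewrite in_itv /=.
  have /andP[l1 l2] := ceil_itv t.
  rewrite -[X in _ * t + X]mulr1 -mulrDr ler_pM2l// ltr_pM2l// l2/=.
  by move: l1; rewrite intrB mulr1z; lra.
have /andP[l1 l2] := floor_itv t.
rewrite -[X in _ * t + X]mulr1 -mulrDr ler_pM2l// ltr_pM2l// l2/=.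
by rewrite intrD mulr1z lerD2r.
Qed.

Lemma is_cube_dist d s (A : set 'rV[R]_d) x y :
  0 < s -> is_cube s A -> A x -> A y -> `|x - y| < s.
Proof.
move=> s0 [a [b ->]] Ax Ay; apply: norm_rV_lt => // i; rewrite !mxE ltr_norml.
move: (Ax i) (Ay i); case: (b i); rewrite !in_itv/=; lra.
Qed.

(** In dimension 0 a cube puts no constraint on s, hence [0 < d]. This disposes of nonpositive side
    lengths. *)
Lemma cube_partition_gt0 d s (A : nat -> set 'rV[R]_d) : (0 < d)%N ->
  cube_partition s A -> 0 < s.
Proof.
move=> d0 [_ A0 Acube].
have : (\bigcup_j A j) 0 by rewrite A0.
move=> [j _]; have [a [b ->]] := Acube j => /(_ (Ordinal d0)).
by case: (b _); rewrite in_itv/=; lra.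
Qed.

(* Every half-open cube of side [s] contains a point of the lattice
   [s Z^d], so disjoint cubes are at most as many as lattice points. *)
Lemma count_cubes_ball d s (A : nat -> set 'rV[R]_d) (y : 'rV[R]_d) r (js : seq nat) :
  cube_partition s A -> 0 < s -> 0 <= r -> uniq js ->
  {in js, forall j, exists2 x, A j x & `|x - y| <= r} ->
  (size js)%:R <= (2 * r / s + 3) ^+ d.
Proof.
move=> [Atriv _ Acube] s0 r0 ujs js_meet.
have /choice[k kP] : forall j, exists k : 'I_d -> int, A j (\row_i (s * (k i)%:~R)).
  by move=> j; exact: is_cube_lattice (Acube j).
pose p j : 'rV[R]_d := \row_i (s * (k j i)%:~R).
(* The lattice point of a cube lies within s of its other points, so the radius grows to r + s; this
   turns the 1 of the grid count into 3. *)
have rs0 : 0 <= r + s by rewrite addr_ge0// ltW.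
have [g gP] := grid_index y s0 rs0.
have pnear j : j \in js -> `|p j - y| <= r + s.
  move=> /js_meet[x Ax xy]; have -> : p j - y = (x - y) + (p j - x).
    by rewrite [RHS]addrC addrA subrK.
  apply: le_trans (ler_normD _ _) _; apply: lerD => //; apply/ltW.
  exact: is_cube_dist (Acube j) (kP j) Ax.
have -> : 2 * r / s + 3 = 2 * (r + s) / s + 1 by field; rewrite gt_eqF.
apply: le_trans (card_grid_le d s0 rs0); rewrite ler_nat.
rewrite -(size_map (g \o p)).
suff gp_uniq : uniq (map (g \o p) js).
  rewrite -(card_uniqP gp_uniq); apply: leq_trans (max_card _) _.
  by rewrite card_ffun !card_ord.
rewrite map_inj_in_uniq// => i j ijs jjs /= gE.
(* Lattice points in one grid class differ by less than s in each coordinate, hence coincide. *)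
have kE l : k i l = k j l.
  have := gP _ _ (pnear _ ijs) (pnear _ jjs) gE l.
  rewrite !mxE -mulrBr normrM (gtr0_norm s0) gtr_pMr// -intrB -intr_norm.
  by rewrite (_ : 1 = 1%:~R)// ltr_int; lia.
apply: (Atriv i j) => //; exists (p i); split; first exact: kP.
by rewrite (_ : p i = p j)//; apply/rowP => l; rewrite !mxE kE.
Qed.

(** Each cube is charged to one point of the net that it comes near. *)
Lemma count_cubes_net d s (A : nat -> set 'rV[R]_d) (ys : seq 'rV[R]_d) r (js : seq nat) :
  cube_partition s A -> 0 < s -> 0 <= r -> uniq js ->
  {in js, forall j, exists x y, [/\ y \in ys, A j x & `|x - y| <= r]} ->
  (size js)%:R <= (size ys)%:R * (2 * r / s + 3) ^+ d.
Proof.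
move=> Apart s0 r0; elim: ys js => [|y ys IH] js ujs js_meet.
  case: js {ujs} js_meet => [|j js] js_meet; first by rewrite mul0r.
  by have [|x [z []]] := js_meet j; rewrite ?mem_head.
pose meet j : bool := `[< exists2 x, A j x & `|x - y| <= r >].
rewrite -(count_predC meet js) -!size_filter natrD /= -[(size ys).+1%:R]natr1 mulrDl mul1r addrC.
apply: lerD; last first.
  apply: (count_cubes_ball (y := y) Apart s0 r0); first exact: filter_uniq.
  by move=> j; rewrite mem_filter => /andP[/asboolP].
apply: IH; first exact: filter_uniq.
move=> j; rewrite mem_filter => /andP[/asboolPn jy jjs].
have [x [z []]] := js_meet _ jjs; rewrite in_cons => /orP[/eqP-> Ax xy|zys Ax xy].
  by exfalso; apply: jy; exists x.
by exists x, z.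
Qed.

(** The image of a t/L-net of the bounded parameter set is a t-net; t <= 1 gives 2 r L / t + 1 <= (2
    r L + 1) / t. *)
Lemma rectifiable_net d m (T : set 'rV[R]_d) : rectifiable m T ->
  exists2 K : R, 0 < K & forall t, 0 < t <= 1 ->
  exists ys : seq 'rV[R]_d, (size ys)%:R <= K / t ^+ m /\
    forall x, T x -> exists2 y, y \in ys & `|x - y| <= t.
Proof.
move=> [_ [B [f [Bbnd flip <-]]]].
have [r r0 Br] : exists2 r : R, 0 <= r & forall b, B b -> `|b| <= r.
  move: Bbnd => [M [_ /(_ (Num.max 0 (M + 1)))]].
  have MM : M < Num.max 0 (M + 1) by rewrite lt_max ltrDl ltr01 orbT.
  move=> /(_ MM) MB; exists (Num.max 0 (M + 1)); first by rewrite le_max lexx.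
  by move=> b Bb; exact: MB.
have [L L0 fL] : exists2 L : R, 0 < L & forall b b', B b -> B b' -> `|f b - f b'| <= L * `|b - b'|.
  move: flip => [M [_ /(_ (Num.max 1 (M + 1)))]].
  have MM : M < Num.max 1 (M + 1) by rewrite lt_max ltrDl ltr01 orbT.
  move=> /(_ MM) fL; exists (Num.max 1 (M + 1)); first by rewrite lt_max ltr01.
  by move=> b b' Bb Bb'; exact: (fL (b, b')).
exists ((2 * r * L + 1) ^+ m); first by rewrite exprn_gt0// ltr_wpDl// !mulr_ge0 ?(ltW L0).
move=> t /andP[t0 t1].
have tL0 : 0 < t / L by rewrite divr_gt0.
have [bs [szbs bsB bsnet]] := bounded_net tL0 r0 Br.
exists (map f bs); split.
  rewrite size_map; apply: le_trans szbs _; rewrite -expr_div_n; apply: lerXn2r; rewrite ?nnegrE.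
  - by rewrite addr_ge0// divr_ge0 ?(ltW tL0)// mulr_ge0.
  - by rewrite divr_ge0 ?addr_ge0 ?mulr_ge0 ?(ltW L0) ?(ltW t0).
  rewrite ler_pdivlMr// mulrDl mul1r invf_div mulrA divfK ?gt_eqF//.
  by rewrite lerD2l.
move=> _ [b Bb <-]; have [b' b'bs bb'] := bsnet _ Bb.
exists (f b'); first exact: map_f.
apply: le_trans (fL _ _ Bb (bsB _ b'bs)) _.
by rewrite mulrC -ler_pdivlMr// ltW.
Qed.

End grids.

(** * The decision boundary and the distance to it *)

Section decision_boundary.
Context (R : realType) (d : nat).
Implicit Types (x y z : 'rV[R]_d) (A S : set 'rV[R]_d).

Lemma closure_normP A z :
  closure A z <-> forall e : R, 0 < e -> exists2 y, A y & `|z - y| < e.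
Proof.
split=> [Az e e0|Az B /nbhs_ballP[e e0 zB]].
  have [y [Ay zy]] := Az _ (nbhsx_ballx z e e0); exists y => //.
  by move: zy; rewrite -ball_normE.
have [y Ay zy] := Az e e0; exists y; split => //; apply: zB.
by rewrite -ball_normE.
Qed.

Lemma cubeX_segment x y (l : R) : cubeX R d x -> cubeX R d y -> 0 <= l <= 1 ->
  cubeX R d (x + l *: (y - x)).
Proof.
move=> Xx Xy /andP[l0 l1] i; move: (Xx i) (Xy i); rewrite !mxE.
move=> /andP[a1 a2] /andP[b1 b2]; apply/andP; split; nra.
Qed.

(** The segment from x to y stays in the convex cube. Its point at the supremum of the parameters
    with values in S is a limit both of points of S and of points outside S. *)
Lemma rel_boundary_segment S x y :
  cubeX R d x -> cubeX R d y -> S x -> ~ S y ->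
  exists2 z, rel_boundary (cubeX R d) S z & `|x - z| <= `|x - y| /\ `|y - z| <= `|x - y|.
Proof.
move=> Xx Xy Sx Sy.
pose c (l : R) := x + l *: (y - x).
pose E := [set l : R | 0 <= l <= 1 /\ S (c l)].
have E0 : E 0 by split; rewrite ?lexx ?ler01// /c scale0r addr0.
have Eub : ubound E 1 by move=> l [/andP[]].
have Esup : has_sup E by split; [exists 0|exists 1].
set l0 := sup E.
have supP l : E l -> l <= l0 by exact: (ub_le_sup Esup.2).
have l0_ge0 : 0 <= l0 by exact: supP.
have l0_le1 : l0 <= 1 by apply: ge_sup => //; exists 0.
have cB l l' : `|c l - c l'| = `|l - l'| * `|x - y|.
  by rewrite /c opprD addrACA subrr add0r -scalerBl normrZ (distrC y x).
have c0 : c 0 = x by rewrite /c scale0r addr0.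
have c1 : c 1 = y by rewrite /c scale1r addrC subrK.
have cX l : 0 <= l <= 1 -> cubeX R d (c l) by exact: cubeX_segment.
have xy_ge0 : 0 < `|x - y| + 1 by rewrite ltr_wpDl.
have small (e l : R) : `|l0 - l| < e / (`|x - y| + 1) -> `|c l0 - c l| < e.
  move=> le; rewrite cB; apply: (@le_lt_trans _ _ (`|l0 - l| * (`|x - y| + 1))).
    by rewrite ler_wpM2l// lerDl.
  by rewrite -ltr_pdivlMr.
exists (c l0).
  split; first split; first by apply: cX; rewrite l0_ge0.
  - apply/closure_normP => e e0.
    have [l [l01 Sl] ll0] := sup_adherent (divr_gt0 e0 xy_ge0) Esup.
    exists (c l); first by split => //; exact: cX.
    apply: small; rewrite ger0_norm; first by move: ll0; rewrite -/l0; lra.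
    by rewrite subr_ge0; exact: supP.
  - apply/closure_normP => e e0.
    (* If the supremum is 1, then y itself is the point outside S; otherwise any parameter slightly
       beyond l0 provides one. *)
    have [l0E1|l0_lt1] := eqVneq l0 1.
      exists y; first by split.
      by rewrite l0E1 c1 subrr normr0.
    have l0lt1 : l0 < 1 by rewrite lt_neqAle l0_lt1.
    pose h := e / (`|x - y| + 1).
    have h0 : 0 < h by rewrite divr_gt0.
    pose l := l0 + Num.min (1 - l0) (h / 2).
    have lgt : 0 < Num.min (1 - l0) (h / 2) by rewrite lt_min subr_gt0 l0lt1 divr_gt0.
    have lle : Num.min (1 - l0) (h / 2) <= 1 - l0 by rewrite ge_min lexx.
    have lle2 : Num.min (1 - l0) (h / 2) <= h / 2 by rewrite ge_min lexx orbT.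
    have l01 : 0 <= l <= 1 by apply/andP; split; rewrite /l; lra.
    exists (c l).
      split; first exact: cX.
      move=> Scl; have : l <= l0 by exact: supP.
      by rewrite leNgt /l ltrDl lgt.
    apply: small; rewrite -/h /l opprD addNKr normrN gtr0_norm//.
    by apply: le_lt_trans lle2 _; lra.
split.
  by rewrite -c0 cB c0 sub0r normrN (ger0_norm l0_ge0) ler_piMl.
by rewrite -{1}c1 cB ger0_norm ?subr_ge0// ler_piMl//; lra.
Qed.

Section Delta.
Context (eta : Rd R d -> R).
Hypotheses (bdpos : Xzero eta = rel_boundary (cubeX R d) (Xpos eta))
  (bdneg : Xzero eta = rel_boundary (cubeX R d) (Xneg eta)).

Lemma cubeX_cases x : cubeX R d x -> [\/ Xpos eta x, Xneg eta x | Xzero eta x].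
Proof.
move=> Xx; case: (ltgtP (eta x) (1 / 2)) => h.
- by apply: Or32.
- by apply: Or31.
- by apply: Or33.
Qed.

Lemma set_dist_lt x A (t : R) :
  (set_dist x A < t%:E)%E <-> exists2 z, A z & `|x - z| < t.
Proof.
split.
  move=> /ereal_inf_lt[_ [z Az <-]]; rewrite lte_fin => xz; by exists z.
move=> [z Az xz]; apply: le_lt_trans (_ : (`|x - z|%:E < _)%E); last by rewrite lte_fin.
by apply: ereal_inf_lbound; exists z.
Qed.

Lemma set_dist_ge x A (t : R) :
  (t%:E <= set_dist x A)%E <-> forall z, A z -> t <= `|x - z|.
Proof.
rewrite leNgt; split=> [/negP h z Az|h].
  by rewrite leNgt; apply/negP => xz; apply: h; apply/set_dist_lt; exists z.
by apply/negP => /set_dist_lt[z /h]; rewrite leNgt => /negP.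
Qed.

Lemma DeltaP x : cubeX R d x ->
  [\/ Xneg eta x /\ Delta eta x = set_dist x (Xpos eta),
      Xpos eta x /\ Delta eta x = set_dist x (Xneg eta) |
      Xzero eta x /\ Delta eta x = 0%E].
Proof.
move=> Xx; rewrite /Delta; case: (cubeX_cases Xx) => xE.
- have xN : ~ Xneg eta x by move=> xN; move: xE.2 xN.2; lra.
  by rewrite memNset// mem_set//; apply: Or32.
- by rewrite mem_set//; apply: Or31.
- have xN : ~ Xneg eta x by move=> xN; move: xE.2 xN.2; lra.
  have xP : ~ Xpos eta x by move=> xN'; move: xE.2 xN'.2; lra.
  by rewrite !memNset//; apply: Or33.
Qed.

Lemma Delta_ge0 x : cubeX R d x -> (0 <= Delta eta x)%E.
Proof.
move=> Xx; case: (DeltaP Xx) => -[_ ->] //.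
- by apply/set_dist_ge => z _.
- by apply/set_dist_ge => z _.
Qed.

(** The segment to a point of the opposite class within t crosses the boundary [Xzero], no farther
    away than that point. *)
Lemma Delta_lt_Xzero x (t : R) : cubeX R d x -> 0 < t -> (Delta eta x < t%:E)%E ->
  exists2 z, Xzero eta z & `|x - z| < t.
Proof.
move=> Xx t0; case: (DeltaP Xx) => -[xE ->].
- move=> /set_dist_lt[y yP xy].
  have [|z zb [_ xz]] := rel_boundary_segment yP.1 Xx yP.
    by move=> xP; move: xE.2 xP.2; lra.
  exists z; first by rewrite bdpos.
  by apply: le_lt_trans xz _; rewrite distrC.
- move=> /set_dist_lt[y yN xy].
  have [|z zb [xz _]] := rel_boundary_segment Xx yN.1 xE.
    by move=> yP; move: yN.2 yP.2; lra.
  exists z; first by rewrite bdpos.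
  exact: le_lt_trans xy.
- by move=> _; exists x => //; rewrite subrr normr0.
Qed.

Lemma Xzero_near_Xneg z (e : R) : Xzero eta z -> 0 < e -> exists2 y, Xneg eta y & `|z - y| < e.
Proof.
move=> zE e0; have : rel_boundary (cubeX R d) (Xneg eta) z by rewrite -bdneg.
by move=> [[_ /closure_normP/(_ _ e0)[y [_ ?] ?]] _]; exists y.
Qed.

Lemma Xzero_near_Xpos z (e : R) : Xzero eta z -> 0 < e -> exists2 y, Xpos eta y & `|z - y| < e.
Proof.
move=> zE e0; have : rel_boundary (cubeX R d) (Xpos eta) z by rewrite -bdpos.
by move=> [[_ /closure_normP/(_ _ e0)[y [_ ?] ?]] _]; exists y.
Qed.

(** A point y within s of x is not in the opposite class, whose distance from x is at least t >= s,
    nor in [Xzero], whose points have opposite points arbitrarily close. The triangle inequality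
    then bounds [Delta] at y. *)
Lemma Delta_near x y (t s : R) : cubeX R d x -> cubeX R d y -> 0 < s ->
  `|x - y| < s -> s <= t -> (t%:E <= Delta eta x)%E ->
  ((t - s)%:E <= Delta eta y)%E /\
  ((Xpos eta x /\ Xpos eta y) \/ (Xneg eta x /\ Xneg eta y)).
Proof.
move=> Xx Xy s0 xys st; case: (DeltaP Xx) => -[xE ->].
- move=> /set_dist_ge h.
  have yN : Xneg eta y.
    case: (cubeX_cases Xy) => // yE.
      by have := h _ yE; lra.
    have /(Xzero_near_Xpos yE)[z zP yz] : 0 < s - `|x - y| by rewrite subr_gt0.
    have := h _ zP; have := ler_distD y x z; lra.
  split; last by right.
  case: (DeltaP Xy) => -[yE ->].
  + apply/set_dist_ge => z zP; have := h _ zP; have := ler_distD y x z; lra.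
  + by exfalso; move: yN.2 yE.2; lra.
  + by exfalso; move: yN.2 yE.2; lra.
- move=> /set_dist_ge h.
  have yN : Xpos eta y.
    case: (cubeX_cases Xy) => // yE.
      by have := h _ yE; lra.
    have /(Xzero_near_Xneg yE)[z zP yz] : 0 < s - `|x - y| by rewrite subr_gt0.
    have := h _ zP; have := ler_distD y x z; lra.
  split; last by left.
  case: (DeltaP Xy) => -[yE ->].
  + by exfalso; move: yN.2 yE.2; lra.
  + apply/set_dist_ge => z zP; have := h _ zP; have := ler_distD y x z; lra.
  + by exfalso; move: yN.2 yE.2; lra.
- by rewrite lee_fin => t0; exfalso; lra.
Qed.

End Delta.
End decision_boundary.

(** * Measurability of cubes, classes and sublevel sets of the distance *)

Section measurability.
Context (R : realType) (d : nat).

Lemma measurable_open_rV (A : set (Rd R d)) : open (A : set 'rV[R]_d) -> measurable A.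
Proof. by move=> oA; apply: sub_sigma_algebra. Qed.

Lemma measurable_coord (i : 'I_d) :
  measurable_fun setT (fun x : Rd R d => (x : 'rV[R]_d) ord0 i).
Proof.
apply: (measurability _ (RGenOpens.measurableE R)) => //.
move=> _ [_ [a [b ->]] <-]; rewrite setTI; apply: measurable_open_rV.
apply: open_comp; last exact: interval_open.
by move=> x _; exact: coord_continuous.
Qed.

Lemma measurable_box (I : 'I_d -> interval R) :
  measurable [set x : Rd R d | forall i, (x : 'rV[R]_d) ord0 i \in I i].
Proof.
rewrite (_ : [set x | _] = \bigcap_(i in [set: 'I_d])
    (fun x : Rd R d => (x : 'rV[R]_d) ord0 i) @^-1` [set` I i]).
  apply: fin_bigcap_measurable => // i _; rewrite -[X in measurable X]setTI.
  by apply: measurable_coord.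
by apply/seteqP; split=> x /= xI i; [move=> _|]; exact: xI.
Qed.

Lemma measurable_cubeX : measurable (cubeX R d).
Proof.
rewrite (_ : cubeX R d =
   [set x : Rd R d | forall i, (x : 'rV[R]_d) ord0 i \in `[-1, 1]]).
  exact: measurable_box.
by apply/seteqP; split => x /= xI i; have := xI i; rewrite in_itv.
Qed.

Lemma measurable_is_cube (s : R) (A : set 'rV[R]_d) : is_cube s A ->
  measurable (A : set (Rd R d)).
Proof. by move=> [a [b ->]]; exact: measurable_box. Qed.

Lemma measurable_near (A : set 'rV[R]_d) (t : R) :
  measurable [set x : Rd R d | exists2 z, A z & `|(x : 'rV[R]_d) - z| < t].
Proof.
apply: measurable_open_rV.
rewrite (_ : [set x | _] = \bigcup_(z in A) ball (z : 'rV[R]_d) t).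
  by apply: bigcup_open => z _; exact: ball_open.
apply/seteqP; split => x /=.
  by move=> [z Az xz]; exists z => //; rewrite -ball_normE /= distrC.
by move=> [z Az]; rewrite -ball_normE /= distrC => xz; exists z.
Qed.

Context (eta : Rd R d -> R) (meta : measurable_fun (cubeX R d) eta).

Lemma measurable_Xpos : measurable (Xpos eta).
Proof.
rewrite (_ : Xpos eta = cubeX R d `&` eta @^-1` `]1/2, +oo[%classic).
  exact: meta measurable_cubeX _ (measurable_itv _).
by apply/seteqP; split=> x /= [Xx]; rewrite in_itv /= ?andbT => h; split;
  rewrite // in_itv/= ?andbT.
Qed.

Lemma measurable_Xneg : measurable (Xneg eta).
Proof.
rewrite (_ : Xneg eta = cubeX R d `&` eta @^-1` `]-oo, 1/2[%classic).
  exact: meta measurable_cubeX _ (measurable_itv _).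
by apply/seteqP; split=> x /= [Xx]; rewrite in_itv /= ?andbT => h; split;
  rewrite // in_itv/= ?andbT.
Qed.

Lemma measurable_Xzero : measurable (Xzero eta).
Proof.
rewrite (_ : Xzero eta = cubeX R d `&` eta @^-1` [set 1/2]).
  exact: meta measurable_cubeX _ (measurable_set1 _).
by apply/seteqP; split.
Qed.

(** On each of the two classes [Delta] is a distance to a set, whose strict sublevel sets are open;
    on [Xzero] it vanishes. *)
Lemma measurable_Delta_lt (t : R) :
  measurable [set x | cubeX R d x /\ (Delta eta x < t%:E)%E].
Proof.
have [t0|t0] := ltP 0 t; last first.
  rewrite (_ : [set x | _] = set0)//; apply/seteqP; split => // x [Xx].
  by rewrite ltNge (le_trans _ (Delta_ge0 _ Xx))// lee_fin.
rewrite (_ : [set x | _] =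
    (Xneg eta `&` [set x : Rd R d | exists2 z, Xpos eta z & `|(x : 'rV[R]_d) - z| < t]) `|`
    (Xpos eta `&` [set x : Rd R d | exists2 z, Xneg eta z & `|(x : 'rV[R]_d) - z| < t]) `|`
    Xzero eta).
  apply: measurableU; last exact: measurable_Xzero.
  apply: measurableU; apply: measurableI; try exact: measurable_near.
    exact: measurable_Xneg.
  exact: measurable_Xpos.
apply/seteqP; split => x /=.
  move=> [Xx]; case: (DeltaP eta Xx) => -[xE ->].
  - by move=> /set_dist_lt h; left; left.
  - by move=> /set_dist_lt h; left; right.
  - by move=> _; right.
have Xx : (Xneg eta x \/ Xpos eta x) \/ Xzero eta x -> cubeX R d x.
  by move=> [[[]|[]]|[]].
move=> xE; have {}Xx : cubeX R d x by apply: Xx; move: xE => [[[]|[]]|]; tauto.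
split => //; case: (DeltaP eta Xx) => -[x1 ->].
- apply/set_dist_lt; move: xE => [[[]|[x2]]|x2] //; exfalso; move: x1.2 x2.2; lra.
- apply/set_dist_lt; move: xE => [[[x2]|[]]|x2] //; exfalso; move: x1.2 x2.2; lra.
- by rewrite lte_fin.
Qed.

End measurability.

(** * Subadditivity of the integral over unions of sets *)

Section integral_setU_le.
Context (R : realType) (dsp : measure_display) (T : measurableType dsp).
Context (mu : {measure set T -> \bar R}) (X : set T) (f : T -> \bar R).
Hypotheses (mX : measurable X) (mf : measurable_fun X f)
  (f0 : forall x, X x -> (0 <= f x)%E).

Lemma integral_setU_le (A B : set T) : measurable A -> measurable B ->
  A `<=` X -> B `<=` X ->
  (\int[mu]_(x in A `|` B) f x <= \int[mu]_(x in A) f x + \int[mu]_(x in B) f x)%E.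
Proof.
move=> mA mB AX BX; have ABX : A `|` B `<=` X by move=> x [/AX|/BX].
have BAX : B `\` A `<=` X by move=> x [/BX].
have mBA : measurable (B `\` A) by exact: measurableD.
have -> : A `|` B = A `|` (B `\` A).
  apply/seteqP; split=> x; last by move=> [Ax|[Bx _]]; [left|right].
  by have [Ax|Ax] := pselect (A x); [left|move=> [//|Bx]; right].
rewrite ge0_integral_setU//.
- apply: leeD2l; apply: ge0_subset_integral => //.
  + exact: (measurable_funS mX BX mf).
  + by move=> x /BX/f0.
- by apply: measurable_funS mf => // x [/AX|/BAX].
- by move=> x [/AX|/BAX] /f0.
- by apply/disj_setPS => x [Ax []].
Qed.

Lemma integral_bigsetU_le (I : Type) (s : seq I) (P : pred I) (F : I -> set T) :
  (forall i, measurable (F i)) -> (forall i, F i `<=` X) ->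
  (\int[mu]_(x in \big[setU/set0]_(i <- s | P i) F i) f x <=
   \sum_(i <- s | P i) \int[mu]_(x in F i) f x)%E.
Proof.
move=> mF FX; elim: s => [|i s IH]; first by rewrite !big_nil integral_set0.
have mU : measurable (\big[setU/set0]_(i <- s | P i) F i) by exact: bigsetU_measurable.
have UX : \big[setU/set0]_(i <- s | P i) F i `<=` X.
  by elim/big_ind : _ => // A B AX BX x [/AX|/BX].
rewrite !big_cons; case: ifP => // _.
by apply: le_trans (integral_setU_le (mF i) mU (@FX i) UX) _; exact: leeD2l.
Qed.

End integral_setU_le.

(** * Excess risk as an integral over the misclassified points *)

Section excess_risk.
Context (R : realType) (d : nat) (P : probability (XY R d) R) (eta : Rd R d -> R).
Hypotheses (PX1 : on_cubeX P) (eta_post : is_posterior P eta).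
Local Notation X := (cubeX R d).
Local Notation PX := (marginal P).
Local Notation mX := (@measurable_cubeX R d).

Let noise (x : Rd R d) : \bar R := `|2 * eta x - 1|%:E.
Let minr (x : Rd R d) : \bar R := (Num.min (eta x) (1 - eta x))%:E.

Let meta : measurable_fun X eta. Proof. by case: eta_post. Qed.

Lemma posterior_bound x : X x -> 0 <= eta x <= 1.
Proof. by case: eta_post => _ h _; exact: h. Qed.

Lemma measurable_noise : measurable_fun X noise.
Proof.
apply/measurable_EFinP; apply: measurableT_comp => //.
by apply: measurable_funB => //; apply: measurable_funM.
Qed.

Lemma integral_noise_ge0 A : (0 <= \int[PX]_(x in A) noise x)%E.
Proof. by apply: integral_ge0 => x _; rewrite lee_fin. Qed.

Lemma noise_le1 x : X x -> (noise x <= 1)%E.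
Proof. by move=> /posterior_bound h; rewrite lee_fin ler_norml; lra. Qed.

Lemma marginal_le1 B : measurable B -> (PX B <= 1)%E.
Proof. exact: probability_le1. Qed.

Lemma integral_marginal_fin (f : Rd R d -> R) B : measurable B -> B `<=` X ->
  measurable_fun B f -> (forall x, B x -> 0 <= f x <= 1) ->
  (\int[PX]_(x in B) (f x)%:E <= PX B)%E /\
  (\int[PX]_(x in B) (f x)%:E)%E \is a fin_num.
Proof.
move=> mB BX mf f01.
have le : (\int[PX]_(x in B) (f x)%:E <= PX B)%E.
  rewrite -[leRHS]mul1e -integral_cst//; apply: ge0_le_integral => //.
  - by move=> x /f01; rewrite lee_fin => /andP[].
  - exact/measurable_EFinP.
  - by move=> x /f01; rewrite lee_fin => /andP[].
split => //; rewrite ge0_fin_numE.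
  by apply: le_lt_trans le _; apply: le_lt_trans (marginal_le1 mB) _; rewrite ltry.
by apply: integral_ge0 => x /f01; rewrite lee_fin => /andP[].
Qed.

Lemma posterior_true B : measurable B -> B `<=` X ->
  P (B `*` [set true]) = (\int[PX]_(x in B) (eta x)%:E)%E.
Proof. by case: eta_post => _ _; apply. Qed.

(** Both labels together carry the mass of B, the integral of eta + (1 - eta); the finite integral
    of eta is then cancelled. *)
Lemma posterior_false B : measurable B -> B `<=` X ->
  P (B `*` [set false]) = (\int[PX]_(x in B) (1 - eta x)%:E)%E.
Proof.
move=> mB BX; have mBeta : measurable_fun B eta by exact: (measurable_funS mX BX meta).
have b01 x : B x -> 0 <= eta x <= 1 by move=> /BX/posterior_bound.
have [_ fin_true] := integral_marginal_fin mB BX mBeta b01.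
have : (P (B `*` [set true]) + P (B `*` [set false]) =
        \int[PX]_(x in B) (eta x)%:E + \int[PX]_(x in B) (1 - eta x)%:E)%E.
  rewrite -measureU; first last.
  - by apply/seteqP; split => // -[x b] [[_ /= ->] [_ /=]].
  - exact: measurableX.
  - exact: measurableX.
  rewrite -ge0_integralD//; first last.
  - by apply/measurable_EFinP; apply: measurable_funB.
  - by move=> x /b01; rewrite lee_fin; lra.
  - exact/measurable_EFinP.
  - by move=> x /b01; rewrite lee_fin; lra.
  have -> : (\int[PX]_(x in B) ((eta x)%:E + (1 - eta x)%:E) = \int[PX]_(x in B) 1)%E.
    by apply: eq_integral => x _; rewrite -EFinD addrC subrK.
  rewrite integral_cst// mul1e /marginal /distribution /pushforward.
  congr (P _); apply/seteqP; split => -[x b]; first by move=> [] [].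
  by case: b => Bx; [left|right].
rewrite posterior_true//; set I1 := (\int[PX]_(x in B) (eta x)%:E)%E in fin_true *.
by move=> /(congr1 (fun y => y - I1)%E); rewrite addeAC [RHS]addeAC subee// !add0e.
Qed.

(** Points with eta = 1/2 are absent because both predictions cost the same there; a zero score
    predicts label 1, as in [sgn]. *)
Definition wrong_set (f : Rd R d -> R) : set (Rd R d) :=
  [set x | Xpos eta x /\ f x < 0] `|` [set x | Xneg eta x /\ 0 <= f x].

Lemma class_lossE (b : bool) (t : R) :
  class_loss (label R b) t = (b != (0 <= t))%:R.
Proof.
rewrite /class_loss /sgn /label indicE; congr (nat_of_bool _)%:R.
case: b; case: (0 <= t); rewrite ?mulr1 ?mulrN1 ?opprK ?mul1r;
  by [rewrite mem_set//= lerN10|rewrite memNset//= => h; move: h; rewrite ?ler10//; lra].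
Qed.

Section risk.
Context (f : Rd R d -> R).
Hypothesis mf : measurable (X `&` [set x | 0 <= f x]).

Let Fp := X `&` [set x | 0 <= f x].
Let Fn := X `\` Fp.

Let mFn : measurable Fn. Proof. exact: measurableD mX mf. Qed.
Let FnX : Fn `<=` X. Proof. by move=> x []. Qed.
Let FpX : Fp `<=` X. Proof. by move=> x []. Qed.
Let FnP x : Fn x <-> X x /\ f x < 0.
Proof.
split=> [[Xx h]|[Xx fx]].
  by split => //; rewrite ltNge; apply/negP => fx; apply: h.
by split => // -[_ /=]; rewrite leNgt fx.
Qed.

Lemma measurable_wrong_set : measurable (wrong_set f).
Proof.
rewrite (_ : wrong_set f = (Xpos eta `&` Fn) `|` (Xneg eta `&` Fp)).
  apply: measurableU; apply: measurableI => //; first exact: measurable_Xpos.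
  exact: measurable_Xneg.
apply/seteqP; split=> x /=.
  by move=> [[xE fx]|[xE fx]]; [left; split => //; apply/FnP|right; split => //];
    split => //; exact: xE.1.
by move=> [[xE /FnP[_ fx]]|[xE [_ fx]]]; [left|right].
Qed.

Lemma riskE : risk P f =
  (\int[PX]_(x in Fn) (eta x)%:E + \int[PX]_(x in Fp) (1 - eta x)%:E)%E.
Proof.
rewrite -posterior_true// -posterior_false//.
rewrite -measureU; first last.
- by apply/seteqP; split => // -[x b] [[_ /= ->] [_ /=]].
- exact: measurableX.
- exact: measurableX.
have mE : measurable (Fn `*` [set true] `|` Fp `*` [set false]).
  by apply: measurableU; exact: measurableX.
have mXT : measurable (X `*` [set: bool]) by apply: measurableX => //; exact: mX.
rewrite /risk.
transitivity (\int[P]_(z in X `*` [set: bool])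
    (\1_(Fn `*` [set true] `|` Fp `*` [set false]) z)%:E)%E.
  apply: eq_integral => -[x b]; rewrite inE => -[/= Xx _].
  rewrite class_lossE indicE; congr ((nat_of_bool _)%:R%:E).
  case: b; case: (leP 0 (f x)) => fx /=; apply/esym.
  - by rewrite memNset//= => -[[[_ h] _]|[]//]; apply: h; split.
  - by rewrite mem_set//=; left; split => //; apply/FnP.
  - by rewrite mem_set//=; right; split.
  - by rewrite memNset//= => -[[]//|[[_ /=]]]; rewrite leNgt fx.
rewrite integral_indic// setIidl// => -[x b] [[/FnX]|[/FpX]] //.
Qed.

(** Pointwise a prediction costs eta or 1 - eta: the minimum of the two, plus |2 eta - 1| if the
    larger one is paid. *)
Lemma risk_min_noise :
  risk P f = (\int[PX]_(x in X) minr x + \int[PX]_(x in wrong_set f) noise x)%E.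
Proof.
have XE : X = Fn `|` Fp.
  apply/seteqP; split=> [x Xx|x [/FnX|/FpX]//].
  by have [fx|fx] := leP 0 (f x); [right|left; apply/FnP].
have mminr : measurable_fun X minr.
  by apply/measurable_EFinP; apply: measurable_minr => //; apply: measurable_funB.
have minr0 x : X x -> (0 <= minr x)%E.
  by move=> /posterior_bound h; rewrite lee_fin le_min; lra.
have disjF : [disjoint Fn & Fp] by apply/disj_setPS => x [[]].
rewrite riskE [X in integral _ X minr]XE ge0_integral_setU//; first last.
- by move=> x; rewrite -XE => /minr0.
- by rewrite -XE.
have split_noise (F : set (Rd R d)) (g : Rd R d -> R) (S : set (Rd R d)) :
    measurable F -> F `<=` X -> measurable S -> 
    (forall x, F x -> (g x)%:E = (minr x + (noise \_ S) x)%E) ->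
    (\int[PX]_(x in F) (g x)%:E =
     \int[PX]_(x in F) minr x + \int[PX]_(x in F `&` S) noise x)%E.
  move=> mF FX mS gE; rewrite integral_mkcondr -ge0_integralD//.
  - by apply: eq_integral => x; rewrite inE => /gE.
  - by move=> x /FX/minr0.
  - exact: (measurable_funS mX FX mminr).
  - by move=> x _; rewrite /patch; case: ifP; rewrite ?lee_fin.
  - apply/(measurable_restrict noise mS mF).
    by apply: measurable_funS measurable_noise; [exact: mX|move=> x [/FX]].
rewrite (split_noise Fn eta (Xpos eta))//; first last.
- move=> x /FnX Xx; rewrite /patch; case: ifPn => [/set_mem xp|/negP xp].
    rewrite -EFinD ger0_norm ?min_r; first by congr EFin; ring.
      by move: xp.2; lra.
    by move: xp.2; lra.
  rewrite adde0 /minr min_l//.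
  have := posterior_bound Xx; have [|h] := ltP (1 / 2) (eta x); last by lra.
  by move=> h; exfalso; apply: xp; apply/mem_set; split.
- exact: measurable_Xpos.
rewrite (split_noise Fp (fun x => 1 - eta x) (Xneg eta))//; first last.
- move=> x /FpX Xx; rewrite /patch; case: ifPn => [/set_mem xp|/negP xp].
    rewrite -EFinD ler0_norm ?min_l; first by congr EFin; ring.
      by move: xp.2; lra.
    by move: xp.2; lra.
  rewrite adde0 /minr min_r//.
  have := posterior_bound Xx; have [|h] := ltP (eta x) (1 / 2); last by lra.
  by move=> h; exfalso; apply: xp; apply/mem_set; split.
- exact: measurable_Xneg.
rewrite addeACA; congr (_ + _)%E.
rewrite -ge0_integral_setU//.
- congr integral; apply/seteqP; split => x.
    move=> [[/FnP[Xx fx] xp]|[[Xx fx] xn]]; [left|right]; by split.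
  by move=> [[xp fx]|[xn fx]]; [left|right]; split => //;
    [apply/FnP; case: xp|split => //; case: xn].
- by apply: measurableI => //; exact: measurable_Xpos.
- by apply: measurableI => //; exact: measurable_Xneg.
- by apply: measurable_funS measurable_noise; [exact: mX|move=> x [[/FnX]|[/FpX]]].
- by move=> x _; rewrite lee_fin.
- by apply/disj_setPS => x [[[_ h] _] [/h]].
Qed.

End risk.

Lemma excess_risk_le (f : Rd R d -> R) :
  measurable (X `&` [set x | 0 <= f x]) ->
  (risk P f - bayes_risk P <= \int[PX]_(x in wrong_set f) noise x)%E.
Proof.
move=> mf.
have min01 x : X x -> 0 <= Num.min (eta x) (1 - eta x) <= 1.
  by move=> /posterior_bound h; rewrite le_min ge_min; lra.
have mmin : measurable_fun X (fun x => Num.min (eta x) (1 - eta x)).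
  by apply: measurable_minr => //; apply: measurable_funB.
have [_ fin_min] := integral_marginal_fin mX (@subset_refl _ X) mmin min01.
have bayes_ge : (\int[PX]_(x in X) minr x <= bayes_risk P)%E.
  apply/ereal_infP => _ [g mg <-]; rewrite risk_min_noise; last first.
    rewrite (_ : [set x | 0 <= g x] = g @^-1` `[0, +oo[%classic).
      exact: mg mX _ (measurable_itv _).
    by apply/seteqP; split=> x /=; rewrite in_itv/= andbT.
  by rewrite leeDl// integral_noise_ge0.
(* Moving the Bayes risk across the inequality requires it to be finite: it lies between the
   integral of min(eta, 1 - eta) and the risk of the constant score 1. *)
rewrite risk_min_noise// leeBlDr; last first.
  rewrite fin_numElt (lt_le_trans _ bayes_ge)/=; last first.
    apply: (@lt_le_trans _ _ 0%E); first exact: ltNy0.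
    by apply: integral_ge0 => x /min01; rewrite lee_fin => /andP[].
  have mT : measurable (X `&` [set x : Rd R d | 0 <= (fun=> 1 : R) x]).
    rewrite (_ : [set x | _] = setT) ?setIT; first exact: mX.
    by apply/seteqP; split=> x /=.
  apply: (@le_lt_trans _ _ (risk P (fun=> 1))).
    by apply: ereal_inf_lbound; exists (fun=> 1) => //; exact: measurable_cst.
  rewrite risk_min_noise// lte_add_pinfty//.
    by rewrite -ge0_fin_numE// integral_ge0// => x /min01; rewrite lee_fin => /andP[].
  have mW := measurable_wrong_set mT.
  have WX : wrong_set (fun=> 1) `<=` X by move=> x [[[]]|[[]]].
  rewrite -ge0_fin_numE ?integral_noise_ge0//.
  have [||_ //] := @integral_marginal_fin (fun x => `|2 * eta x - 1|) _ mW WX _ _.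
    by apply/measurable_EFinP; exact: (measurable_funS mX WX measurable_noise).
  by move=> x /WX/[dup] Xx /noise_le1; rewrite lee_fin normr_ge0.
by rewrite addeC; exact: leeD2l.
Qed.

End excess_risk.

(** * The histogram rule as a majority vote in each cell *)

Section histogram.
Context (R : realType) (d : nat) (A : nat -> set 'rV[R]_d) (s : R).
Hypothesis Apart : cube_partition s A.

Lemma cell_of (j : nat) (x : 'rV[R]_d) : A j x -> cell A x = A j.
Proof.
move=> Ax; apply/seteqP; split=> [y [k /= Akx Aky]|y Ay]; last by exists j.
have [Atriv _ _] := Apart.
by rewrite (Atriv j k)//; exists x.
Qed.

Lemma cell_exists (x : 'rV[R]_d) : exists j, A j x.
Proof.
have [_ AT _] := Apart; have : [set: 'rV[R]_d] x by [].
by rewrite -AT => -[j _ Ax]; exists j.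
Qed.

Lemma measurable_cell j : measurable (A j : set (Rd R d)).
Proof. by have [_ _ Acube] := Apart; exact: measurable_is_cube (Acube j). Qed.

Definition cell_label (j : nat) (b : bool) : set (XY R d) := A j `*` [set b].

Lemma measurable_cell_label j b : measurable (cell_label j b).
Proof. by apply: measurableX => //; exact: measurable_cell. Qed.

Lemma hist_rule_ge0 n (D : n.-tuple (XY R d)) j (x : Rd R d) : (0 < n)%N -> A j x ->
  (0 <= hist_rule A D x) =
  (\sum_(i < n) \1_(cell_label j false) (tnth D i) <=
   \sum_(i < n) \1_(cell_label j true) (tnth D i) :> R).
Proof.
move=> n0 Ax; rewrite /hist_rule /sgn.
have -> : (0 <= (if 0 <= hist_score A D x then 1 else -1 : R)) = (0 <= hist_score A D x).
  by case: (0 <= hist_score A D x); rewrite ?ler01 ?ler0N1.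
rewrite /hist_score (cell_of Ax) subr_ge0 ler_pM2l ?invr_gt0 ?ltr0n//.
have indE b (z : XY R d) :
    (label R z.2 == label R b)%:R * \1_(A j) z.1 = \1_(cell_label j b) z :> R.
  rewrite !indicE -natrM mulnb; congr (nat_of_bool _)%:R.
  have labE (b1 b2 : bool) : (label R b1 == label R b2) = (b1 == b2).
    have h : (1 == -1 :> R) = false by apply/negbTE; rewrite eq_sym lt_eqF//; lra.
    by case: b1; case: b2; rewrite /label/= ?eqxx// ?h// eq_sym h.
  rewrite labE; apply/andP/idP => [[/eqP zb /set_mem Az]|/set_mem[Az zb]].
    by apply/mem_set; split.
  by split; [apply/eqP|apply/mem_set].
under eq_bigr => i _ do rewrite (indE false).
by under [leRHS]eq_bigr => i _ do rewrite (indE true).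
Qed.

Lemma measurable_hist_rule_ge0 n (D : n.-tuple (XY R d)) : (0 < n)%N ->
  measurable (cubeX R d `&` [set x | 0 <= hist_rule A D x]).
Proof.
move=> n0; rewrite (_ : _ `&` _ = cubeX R d `&` \bigcup_(j in [set j |
   \sum_(i < n) \1_(cell_label j false) (tnth D i) <=
   \sum_(i < n) \1_(cell_label j true) (tnth D i) :> R]) A j).
  apply: measurableI; first exact: measurable_cubeX.
  by apply: bigcup_measurable => j _; exact: measurable_cell.
apply/seteqP; split=> x /= [Xx].
  move=> hx; split => //; have [j Ax] := cell_exists x; exists j => //=.
  by rewrite -(hist_rule_ge0 _ _ Ax).
by move=> [j /= hj Ax]; split => //; rewrite (hist_rule_ge0 _ _ Ax).
Qed.

(* A set of samples that only depends on the cells and labels of the data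
   points is a countable union of measurable cylinders. *)
Lemma measurable_pattern n (S : set (n.-tuple (XY R d))) :
  (forall D D', (forall i, (tnth D i).2 = (tnth D' i).2) ->
     (forall i j, A j (tnth D i).1 <-> A j (tnth D' i).1) -> S D -> S D') ->
  measurable S.
Proof.
move=> Ssat.
pose cyl (p : {ffun 'I_n -> nat * bool}) : set (n.-tuple (XY R d)) :=
  \bigcap_(i in [set: 'I_n]) ((@tnth n (XY R d))^~ i @^-1` cell_label (p i).1 (p i).2).
have mcyl p : measurable (cyl p).
  apply: fin_bigcap_measurable => // i _; rewrite -[X in measurable X]setTI.
  by apply: measurable_tnth => //; exact: measurable_cell_label.
rewrite (_ : S = \bigcup_p (if `[< cyl p `<=` S >] then cyl p else set0)); last first.
  apply/seteqP; split=> D; last by move=> [p _]; case: asboolP => // pS /pS.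
  move=> SD; have /choice[k kP] : forall i, exists j, A j (tnth D i).1.
    by move=> i; exact: cell_exists.
  pose p := [ffun i => (k i, (tnth D i).2)].
  have Dp : cyl p D by move=> i _; rewrite /cell_label /p /= ffunE; split => //=; exact: kP.
  exists p => //; case: asboolP => // -[] D' D'p; apply: (Ssat D D') => //.
    by move=> i; have [_] := D'p i I; rewrite /p ffunE.
  move=> i j; have [/=] := D'p i I; rewrite /p ffunE /= => AD' _.
  have [Atriv _ _] := Apart.
  have cE (x y : 'rV[R]_d) : A (k i) x -> A (k i) y -> A j x -> A j y.
    move=> Akx Aky Ajx; rewrite (_ : j = k i)//.
    by apply: (Atriv j (k i)) => //; exists x.
  by split; apply: cE.
apply: countable_bigcupT_measurable; first exact: countableP.
by move=> p; case: ifP.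
Qed.

(** Together with [measurable_pattern], this makes the event of small excess risk measurable. *)
Lemma hist_rule_pattern n (D D' : n.-tuple (XY R d)) :
  (forall i, (tnth D i).2 = (tnth D' i).2) ->
  (forall i j, A j (tnth D i).1 <-> A j (tnth D' i).1) ->
  hist_rule A D = hist_rule A D'.
Proof.
move=> lab cells; apply/funext => x; rewrite /hist_rule; congr sgn.
have indE i : \1_(cell A x) (tnth D i).1 = \1_(cell A x) (tnth D' i).1 :> R.
  have [j Ax] := cell_exists x; rewrite (cell_of Ax) !indicE; congr (nat_of_bool _)%:R.
  by apply/idP/idP => /set_mem h; apply/mem_set/cells.
rewrite /hist_score; under eq_bigr => i _ do rewrite lab indE.
by under [X in _ - _ * X]eq_bigr => i _ do rewrite lab indE.
Qed.

End histogram.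

(** * Expected loss of a cell and the resulting oracle inequality *)

Section oracle.
Context (R : realType) (d : nat) (P : probability (XY R d) R) (eta : Rd R d -> R).
Context (A : nat -> set 'rV[R]_d) (s : R) (n : nat).
Hypotheses (PX1 : on_cubeX P) (eta_post : is_posterior P eta).
Hypotheses (Apart : cube_partition s A) (n_gt0 : (0 < n)%N).
Local Notation X := (cubeX R d).
Local Notation PX := (marginal P).
Local Notation mX := (@measurable_cubeX R d).
Local Notation noise := (fun x => `|2 * eta x - 1|%:E).

Let C j : set (Rd R d) := A j `&` X.
Let mC j : measurable (C j).
Proof. by apply: measurableI; [exact: (measurable_cell Apart)|exact: mX]. Qed.
Let CX j : C j `<=` X. Proof. by move=> x []. Qed.
Let meta : measurable_fun X eta. Proof. by case: eta_post. Qed.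
Let mCeta j : measurable_fun (C j) eta.
Proof. exact: (measurable_funS mX (@CX j) meta). Qed.

Definition cell_mass (j : nat) : R := fine (PX (C j)).
Definition cell_noise (j : nat) : R := fine (\int[PX]_(x in C j) noise x)%E.

Lemma cell_massE j : PX (C j) = (cell_mass j)%:E.
Proof.
rewrite /cell_mass fineK// ge0_fin_numE//.
by apply: le_lt_trans (marginal_le1 P (mC j)) _; rewrite ltry.
Qed.

Lemma cell_mass_ge0 j : 0 <= cell_mass j.
Proof. by rewrite -lee_fin -cell_massE. Qed.

Let noise01 x : X x -> 0 <= `|2 * eta x - 1| <= 1.
Proof. by move=> /(noise_le1 eta_post); rewrite lee_fin normr_ge0. Qed.

Lemma integral_noise_fin B : measurable B -> B `<=` X ->
  (\int[PX]_(x in B) noise x)%E \is a fin_num.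
Proof.
move=> mB BX; have [||_ //] := @integral_marginal_fin _ _ P (fun x => `|2 * eta x - 1|) _ mB BX.
  apply/measurable_EFinP.
  exact: (measurable_funS mX BX (measurable_noise eta_post)).
by move=> x /BX/noise01.
Qed.

Lemma cell_noiseE j : (\int[PX]_(x in C j) noise x = (cell_noise j)%:E)%E.
Proof. by rewrite /cell_noise fineK// integral_noise_fin. Qed.

Lemma cell_noise_ge0 j : 0 <= cell_noise j.
Proof. by rewrite -lee_fin -cell_noiseE; exact: integral_noise_ge0. Qed.

(** Cells may stick out of X, while the posterior is specified on X only. *)
Lemma prob_on_cubeX (B : set (XY R d)) : measurable B ->
  P B = P (B `&` (X `*` [set: bool])).
Proof.
move=> mB; have mXT : measurable (X `*` [set: bool]).
  by apply: measurableX => //; exact: mX.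
have -> : P B = (P (B `\` (X `*` [set: bool])) + P (B `&` (X `*` [set: bool])))%E.
  exact: measureDI.
suff -> : P (B `\` (X `*` [set: bool])) = 0%E by rewrite add0e.
apply/eqP; rewrite eq_le measure_ge0 andbT.
have <- : P (~` (X `*` [set: bool])) = 0%E by rewrite probability_setC// PX1 subee.
apply: le_measure; rewrite ?inE; [exact: measurableD|exact: measurableC|].
by move=> z [].
Qed.

Lemma prob_cell_label j b :
  P (cell_label A j b) = P (C j `*` [set b]).
Proof.
rewrite prob_on_cubeX; last exact: (measurable_cell_label Apart).
congr (P _); apply/seteqP; split=> -[x c] /=.
  by move=> [[Ax cb] [Xx _]].
by move=> [[Ax Xx] cb].
Qed.

Definition pure_cell j b : Prop :=
  forall x, C j x -> if b then Xpos eta x else Xneg eta x.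

(** The Bayes label of a pure cell. A cell that misses X is pure for both labels and gets [true]. *)
Definition cell_sign j : bool := `[< pure_cell j true >].

Lemma cell_signP j b : pure_cell j b -> pure_cell j (cell_sign j).
Proof.
move=> jb; rewrite /cell_sign; case: asboolP => // jN.
by case: b jb => // /jN.
Qed.

(** Ties count as bad for either sign, so the event contains every misclassification of a pure cell,
    although the rule breaks ties towards label 1. *)
Definition bad_samples j : set (n.-tuple (XY R d)) :=
  [set D | \sum_(i < n) \1_(cell_label A j (cell_sign j)) (tnth D i) <=
           \sum_(i < n) \1_(cell_label A j (~~ cell_sign j)) (tnth D i) :> R].

Lemma measurable_bad_samples j : measurable (bad_samples j).
Proof. by apply: measurable_count_le; exact: (measurable_cell_label Apart). Qed.

(** The masses of the two labels add up to the mass of the cell. Purity fixes the sign of 2 eta - 1,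
    so their difference, correct label minus wrong one, is the noise of the cell. *)
Lemma prob_bad_samples_le j b : pure_cell j b -> 0 < cell_noise j ->
  (prob_power P n (bad_samples j)
   <= (4 * cell_mass j / (n%:R * cell_noise j ^+ 2))%:E)%E.
Proof.
move=> /cell_signP; rewrite /bad_samples; move: (cell_sign j) => {}b jb m0.
have e01 x : C j x -> 0 <= eta x <= 1 by move=> /CX/(posterior_bound eta_post).
have mCeta1 : measurable_fun (C j) (fun x => 1 - eta x) by apply: measurable_funB.
have [_ /fineK pE] := integral_marginal_fin P (mC j) (@CX j) (@mCeta j) e01.
have [|_ /fineK rE] := integral_marginal_fin P (mC j) (@CX j) mCeta1.
  by move=> x /e01; lra.
set p := fine _ in pE; set r := fine _ in rE.
have mN : measurable_fun (C j) noise.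
  exact: (measurable_funS mX (@CX j) (measurable_noise eta_post)).
have pge0 : 0 <= p by rewrite -lee_fin pE integral_ge0// => x /e01; rewrite lee_fin; lra.
have rge0 : 0 <= r by rewrite -lee_fin rE integral_ge0// => x /e01; rewrite lee_fin; lra.
have prE : p + r = cell_mass j.
  apply: EFin_inj; rewrite EFinD pE rE -cell_massE -ge0_integralD//.
  - transitivity (\int[PX]_(x in C j) 1)%E; last by rewrite integral_cst// mul1e.
    by apply: eq_integral => x _; rewrite -EFinD addrC subrK.
  - by move=> x /e01; rewrite lee_fin; lra.
  - exact/measurable_EFinP.
  - by move=> x /e01; rewrite lee_fin; lra.
  - exact/measurable_EFinP.
have Ptrue : P (cell_label A j true) = p%:E by rewrite prob_cell_label pE (posterior_true eta_post).
have Pfalse : P (cell_label A j false) = r%:E.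
  by rewrite prob_cell_label rE (posterior_false eta_post).
have mcl c := measurable_cell_label Apart j c.
have disj c : cell_label A j c `&` cell_label A j (~~ c) = set0.
  by apply/seteqP; split=> // -[x c'] /= [[_ /= ->] [_ /=]]; case: c.
case: b jb => jb.
  have mE : p - r = cell_noise j.
    apply/eqP; rewrite subr_eq addrC; apply/eqP; apply: EFin_inj.
    rewrite EFinD pE rE -cell_noiseE -ge0_integralD//.
    - apply: eq_integral => x; rewrite inE => /jb[_ h]; rewrite -EFinD.
      by rewrite ger0_norm; [congr EFin; ring|lra].
    - by move=> x /e01; rewrite lee_fin; lra.
    - exact/measurable_EFinP.
  rewrite -mE -prE.
  apply: (prob_power_count_le (mcl true) (mcl false) (disj true) n_gt0 Ptrue Pfalse rge0).
  by rewrite -subr_gt0 mE.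
have mE : r - p = cell_noise j.
  apply/eqP; rewrite subr_eq addrC; apply/eqP; apply: EFin_inj.
  rewrite EFinD pE rE -cell_noiseE -ge0_integralD//.
  - apply: eq_integral => x; rewrite inE => /jb[_ h]; rewrite -EFinD.
    by rewrite ltr0_norm; [congr EFin; ring|lra].
  - by move=> x /e01; rewrite lee_fin; lra.
  - exact/measurable_EFinP.
rewrite -mE -prE addrC.
apply: (prob_power_count_le (mcl false) (mcl true) (disj false) n_gt0 Pfalse Ptrue pge0).
by rewrite -subr_gt0 mE.
Qed.

Definition cell_loss j : R := cell_noise j * fine (prob_power P n (bad_samples j)).

Let pn j : R := fine (prob_power P n (bad_samples j)).
Let pnE j : prob_power P n (bad_samples j) = (pn j)%:E.
Proof.
rewrite /pn fineK// ge0_fin_numE//.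
by apply: le_lt_trans (probability_le1 _ (measurable_bad_samples j)) _; rewrite ltry.
Qed.
Let pn01 j : 0 <= pn j <= 1.
Proof.
by rewrite -!lee_fin -pnE measure_ge0 probability_le1//; exact: measurable_bad_samples.
Qed.

Lemma cell_loss_le_noise j : cell_loss j <= cell_noise j.
Proof. by rewrite ler_piMr ?cell_noise_ge0//; case/andP: (pn01 j). Qed.

(** For noise m and mass q, the tail bound leaves m * 4 q / (n m^2) = 4 q / (n m), and q / m <= 1 /
    rho. The case m = 0 is separate because of the division. *)
Lemma cell_loss_le j b (rho : R) : pure_cell j b -> 0 < rho ->
  rho * cell_mass j <= cell_noise j -> cell_loss j <= 4 / (n%:R * rho).
Proof.
move=> jb rho0 qm; have n0 : 0 < n%:R :> R by rewrite ltr0n.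
have nr0 : 0 < n%:R * rho by rewrite mulr_gt0.
have [m0|m0] := ltP 0 (cell_noise j); last first.
  apply: le_trans (cell_loss_le_noise j) _; apply: le_trans m0 _.
  by rewrite divr_ge0// ltW.
have := prob_bad_samples_le jb m0; rewrite pnE lee_fin /cell_loss -/(pn j) => h.
apply: (@le_trans _ _ (cell_noise j * (4 * cell_mass j / (n%:R * cell_noise j ^+ 2)))).
  by rewrite ler_pM2l.
have -> : cell_noise j * (4 * cell_mass j / (n%:R * cell_noise j ^+ 2)) =
          4 * cell_mass j / (n%:R * cell_noise j).
  by field; rewrite !gt_eqF.
rewrite ler_pdivlMr// mulrAC ler_pdivrMr ?mulr_gt0//.
have -> : 4 * cell_mass j * (n%:R * rho) = 4 * n%:R * (rho * cell_mass j) by ring.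
by rewrite [leRHS]mulrA ler_pM2l// mulr_gt0.
Qed.

(** Either the noise is at least lam times the mass, and [cell_loss_le] applies with rho = lam, or
    it is smaller and bounds the loss by itself. *)
Lemma cell_loss_le_split j b (lam : R) : pure_cell j b -> 0 < lam ->
  cell_loss j <= lam * cell_mass j + 4 / (n%:R * lam).
Proof.
move=> jb lam0; have [h|h] := leP (lam * cell_mass j) (cell_noise j).
  apply: le_trans (cell_loss_le jb lam0 h) _; rewrite lerDr.
  by rewrite mulr_ge0 ?cell_mass_ge0// ltW.
apply: le_trans (cell_loss_le_noise j) _; apply: le_trans (ltW h) _.
by rewrite lerDl divr_ge0// mulr_ge0// ltW.
Qed.

Section sample.
Context (js : seq nat) (t0 nu E tau : R).
Hypotheses (js_pure : {in js, forall j, exists b, pure_cell j b})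
  (js_far : forall j x, A j x -> X x -> (t0%:E <= Delta eta x)%E -> j \in js)
  (E_gt0 : 0 < E) (E_ge : \sum_(j <- js) cell_loss j <= E)
  (nu_ge : (\int[PX]_(x in [set x | X x /\ (Delta eta x < t0%:E)%E]) noise x <= nu%:E)%E).

Let Z (D : n.-tuple (XY R d)) : R := \sum_(j <- js) cell_noise j * \1_(bad_samples j) D.

(** A misclassified point outside the near set lies in a pure cell of [js] with a bad sample; the
    whole noise of that cell is charged. *)
Lemma excess_risk_le_bad (D : n.-tuple (XY R d)) :
  (risk P (hist_rule A D) - bayes_risk P <= (nu + Z D)%:E)%E.
Proof.
have mh := measurable_hist_rule_ge0 Apart D n_gt0.
apply: le_trans (excess_risk_le eta_post mh) _.
set near := [set x | X x /\ (Delta eta x < t0%:E)%E].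
have mnear : measurable near by exact: measurable_Delta_lt.
have nearX : near `<=` X by move=> x [].
pose F := \big[setU/set0]_(j <- js | D \in bad_samples j) C j.
have mF : measurable F by exact: bigsetU_measurable.
have FX : F `<=` X by rewrite /F; elim/big_ind : _ => // B1 B2 h1 h2 x [/h1|/h2].
have mnoise := measurable_noise eta_post.
have noise0 x : X x -> (0 <= `|2 * eta x - 1|%:E)%E by rewrite lee_fin.
have WF : wrong_set eta (hist_rule A D) `<=` near `|` F.
  move=> x Wx; have Xx : X x by case: Wx => -[[]].
  have [xn|xf] := ltP (Delta eta x) t0%:E; [by left|right].
  have [j Ax] := cell_exists Apart x.
  have jjs := js_far Ax Xx xf.
  suff Dbad : D \in bad_samples j.
    by rewrite /F -bigcup_seq_cond; exists j => //=; rewrite jjs Dbad.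
  have [b /cell_signP jb] := js_pure jjs; have {jb} := jb x (conj Ax Xx).
  rewrite inE /bad_samples /=.
  case: (cell_sign j) => -[_ xE] /=; case: Wx => -[[_ xE'] hx]; 
    try by have := lt_trans xE xE'; rewrite ltxx.
    by apply: ltW; rewrite ltNge -(hist_rule_ge0 Apart D n_gt0 Ax) -ltNge.
  by rewrite -(hist_rule_ge0 Apart D n_gt0 Ax).
have mW : measurable (wrong_set eta (hist_rule A D)) by exact: measurable_wrong_set eta_post _ mh.
apply: (@le_trans _ _ (\int[PX]_(x in near `|` F) noise x)%E).
  have nFX : near `|` F `<=` X by move=> x [/nearX|/FX].
  apply: ge0_subset_integral => //; first exact: measurableU.
  - exact: (measurable_funS mX nFX mnoise).
apply: le_trans (integral_setU_le PX mX mnoise noise0 mnear mF nearX FX) _.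
rewrite EFinD; apply: leeD => //.
apply: le_trans (integral_bigsetU_le PX mX mnoise noise0 js _ mC CX) _.
rewrite /Z -sumEFin big_mkcond /=; apply: lee_sum => j _.
rewrite indicE; case: ifP => _; last by rewrite mulr0.
by rewrite mulr1 cell_noiseE.
Qed.

Lemma measurable_Z : measurable_fun setT Z.
Proof.
apply: measurable_sum => j; apply: measurable_funM => //.
by apply: measurable_indic; exact: measurable_bad_samples.
Qed.

Lemma integral_Z : (\int[prob_power P n]_D (Z D)%:E <= E%:E)%E.
Proof.
rewrite (_ : (\int[prob_power P n]_D (Z D)%:E)%E = (\sum_(j <- js) cell_loss j)%:E).
  by rewrite lee_fin.
rewrite /Z; under eq_integral do rewrite -sumEFin.
rewrite ge0_integral_sum//.
- rewrite -sumEFin; apply: eq_bigr => j _.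
  under eq_integral do rewrite EFinM.
  rewrite ge0_integralZl_EFin ?cell_noise_ge0//.
    rewrite integral_indic ?setIT//; last exact: measurable_bad_samples.
    by rewrite /cell_loss EFinM -/(pn j) -pnE.
  by apply/measurable_EFinP; apply: measurable_indic; exact: measurable_bad_samples.
- move=> j; apply/measurable_EFinP; apply: measurable_funM => //.
  by apply: measurable_indic; exact: measurable_bad_samples.
- by move=> j D _; rewrite lee_fin mulr_ge0// cell_noise_ge0.
Qed.

(** Only the sum [Z] is random, with mean at most E; exceeding the level e^tau E has probability at
    most e^-tau. *)
Lemma hist_rule_oracle (eps : R) : nu + expR tau * E <= eps ->
  ((1 - expR (- tau))%:E <= prob_power P n
     [set D | risk P (hist_rule A D) - bayes_risk P <= eps%:E])%E.
Proof.
move=> eps_ge; set S := [set D | _].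
have mS : measurable S.
  apply: (measurable_pattern Apart) => D D' lab cells.
  by rewrite /S /= (hist_rule_pattern Apart lab cells).
pose G : set (n.-tuple (XY R d)) := [set D | expR tau * E <= Z D].
have mG : measurable G.
  rewrite -[G]setTI.
  exact: (measurable_fun_ler (measurable_cst _) measurable_Z measurableT (Y := [set true])).
have GS : ~` G `<=` S.
  move=> D /= /negP; rewrite -ltNge => ZE; apply: le_trans (excess_risk_le_bad D) _.
  rewrite lee_fin; apply: le_trans eps_ge; rewrite lerD2l; exact: ltW.
have Gle : (prob_power P n G <= (expR (- tau))%:E)%E.
  have a0 : 0 < expR tau * E by rewrite mulr_gt0// expR_gt0.
  have Z0 D : 0 <= Z D.
    by rewrite /Z; apply: sumr_ge0 => j _; rewrite mulr_ge0// cell_noise_ge0.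
  have : ((expR tau * E)%:E * prob_power P n G <= E%:E)%E.
    apply: le_trans integral_Z.
    rewrite -[X in (_ * X)%E](_ : (\int[prob_power P n]_D (\1_G D)%:E)%E = _); last first.
      by rewrite integral_indic// setIT.
    rewrite -ge0_integralZl_EFin ?(ltW a0)//; last first.
      by apply/measurable_EFinP; exact: measurable_indic.
    apply: ge0_le_integral => //.
    - by move=> D _; rewrite -EFinM lee_fin mulr_ge0// ltW.
    - by apply: measurable_funeM; apply/measurable_EFinP; exact: measurable_indic.
    - apply/measurable_EFinP; exact: measurable_Z.
    - move=> D _; rewrite -EFinM lee_fin indicE.
      by case: (boolP (D \in G)) => [/set_mem|_]; rewrite ?mulr1// mulr0.
  have fG : prob_power P n G \is a fin_num.
    by rewrite ge0_fin_numE//; apply: le_lt_trans (probability_le1 _ mG) _; rewrite ltry.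
  rewrite -(fineK fG) -EFinM !lee_fin => h.
  rewrite expRN -[leRHS]mul1r ler_pdivlMr ?expR_gt0// mulrC.
  by rewrite -(ler_pM2r E_gt0) mul1r mulrAC.
apply: (@le_trans _ _ (prob_power P n (~` G))).
  rewrite probability_setC// EFinB; apply: leeB => //.
apply: le_measure; rewrite ?inE//; exact: measurableC.
Qed.

End sample.
End oracle.

(** * Number of cells near the decision boundary *)

Section near_cells.
Context (R : realType) (d : nat).

Lemma cubeX_norm_le1 (x : 'rV[R]_d) : cubeX R d x -> `|x| <= 1.
Proof.
move=> Xx; rewrite [leLHS]/Num.norm /= mx_normrE.
by apply: bigmax_le => // -[i j] _ /=; rewrite (ord1 i) ler_norml; exact: Xx.
Qed.

(* Only this count uses the rectifiability of the decision boundary. *)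
Lemma count_near_boundary (X0 : set 'rV[R]_d) : rectifiable d.-1 X0 ->
  exists2 K : R, 0 < K &
  forall (eta : Rd R d -> R) (A : nat -> set 'rV[R]_d) (s t : R) (js : seq nat),
    Xzero eta = X0 -> Xzero eta = rel_boundary (cubeX R d) (Xpos eta) ->
    cube_partition s A -> 0 < s -> s <= t -> t <= 1 -> uniq js ->
    {in js, forall j, exists x, [/\ A j x, cubeX R d x & (Delta eta x < (2 * t)%:E)%E]} ->
    (size js)%:R <= K * t / s ^+ d.
Proof.
move=> X0rect; have d1 : (0 < d)%N by rewrite (leq_trans X0rect.1)// leq_pred.
have [K0 K00 net] := rectifiable_net X0rect.
exists (K0 * 9 ^+ d); first by rewrite mulr_gt0// exprn_gt0.
move=> eta A s t js etaX0 bdpos Apart s0 st t1 ujs js_near.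
have t0 : 0 < t by exact: lt_le_trans st.
have [|ys [szys ysnet]] := net t; first by rewrite t0.
(* The radius 3t is 2t from the cell to [Xzero] plus t to the net. As s <= t, 6t/s + 3 <= 9t/s, and
   d - 1 of the d powers of t cancel against the size of the net. *)
have r0 : 0 <= 3 * t by rewrite mulr_ge0// ltW.
apply: (@le_trans _ _ ((size ys)%:R * (2 * (3 * t) / s + 3) ^+ d)).
  apply: (count_cubes_net Apart s0 r0 ujs) => j /js_near[x [Ax Xx xt]].
  have t20 : 0 < 2 * t by rewrite mulr_gt0.
  have [z zX0 xz] := Delta_lt_Xzero bdpos Xx t20 xt.
  have [|y yys zy] := ysnet z; first by rewrite -etaX0.
  exists x, y; split => //; apply: le_trans (ler_distD z x y) _.
  by move: xz zy; lra.
have -> : K0 * 9 ^+ d * t / s ^+ d = K0 / t ^+ d.-1 * (9 * t / s) ^+ d.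
  have tE : t ^+ d = t * t ^+ d.-1 by rewrite -exprS prednK.
  by rewrite !exprMn exprVn tE; field; rewrite !expf_neq0 ?gt_eqF.
apply: ler_pM => //; first by rewrite exprn_ge0// addr_ge0// divr_ge0// ?mulr_ge0// ltW.
apply: lerXn2r; rewrite ?nnegrE.
- by rewrite addr_ge0// divr_ge0 ?(ltW s0)// !mulr_ge0// ltW.
- by rewrite divr_ge0 ?(ltW s0)// !mulr_ge0// ltW.
have ts1 : 1 <= t / s by rewrite ler_pdivlMr// mul1r.
by rewrite -!mulrA; lra.
Qed.

End near_cells.

(** * Loss of the cells far from the decision boundary *)

Section far_cells.
Context (R : realType) (d : nat) (P : probability (XY R d) R) (eta : Rd R d -> R).
Context (A : nat -> set 'rV[R]_d) (s : R) (n : nat).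
Hypotheses (PX1 : on_cubeX P) (eta_post : is_posterior P eta).
Hypotheses (bdpos : Xzero eta = rel_boundary (cubeX R d) (Xpos eta))
  (bdneg : Xzero eta = rel_boundary (cubeX R d) (Xneg eta)).
Hypotheses (Apart : cube_partition s A) (n_gt0 : (0 < n)%N) (s_gt0 : 0 < s).
Local Notation X := (cubeX R d).
Local Notation PX := (marginal P).
Local Notation mX := (@measurable_cubeX R d).
Local Notation noise := (fun x => `|2 * eta x - 1|%:E).
Local Notation loss := (cell_loss P eta A n).

Let le_double (t : R) : s <= t -> s <= 2 * t.
Proof. by move: s_gt0; lra. Qed.

Definition far_cell (t : R) (j : nat) : Prop :=
  exists x, [/\ A j x, X x & (t%:E <= Delta eta x)%E].

Lemma far_cell_pure t j : s <= t -> far_cell t j -> exists b, pure_cell eta A j b.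
Proof.
move=> st [x [Ax Xx xt]]; have [_ _ Acube] := Apart.
have near y : (A j `&` X) y ->
    (Xpos eta x /\ Xpos eta y) \/ (Xneg eta x /\ Xneg eta y).
  move=> [Ay Xy]; have xy := is_cube_dist s_gt0 (Acube j) Ax Ay.
  by have [_] := Delta_near bdpos bdneg Xx Xy s_gt0 xy st xt.
have [[xp _]|[xn _]] := near x (conj Ax Xx).
  exists true => y /near[[]//|[xn _]].
  by have := lt_trans xp.2 xn.2; rewrite ltxx.
exists false => y /near[[xp _]|[]//].
by have := lt_trans xp.2 xn.2; rewrite ltxx.
Qed.

(** A cell has diameter less than s <= t, so one point at distance 2t keeps all others at distance
    t. This is why the layers are delimited by [far_cell (2 * t)]. *)
Lemma far_cell_Delta t j : s <= t -> far_cell (2 * t) j ->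
  forall x, A j x -> X x -> (t%:E <= Delta eta x)%E.
Proof.
move=> st [x [Ax Xx xt]] y Ay Xy; have [_ _ Acube] := Apart.
have xy := is_cube_dist s_gt0 (Acube j) Ax Ay.
have s2t := le_double st.
have [h _] := Delta_near bdpos bdneg Xx Xy s_gt0 xy s2t xt.
by apply: le_trans h; rewrite lee_fin mulr_natl mulr2n -addrA lerDl subr_ge0.
Qed.

Lemma count_cells_cubeX (js : seq nat) : uniq js ->
  {in js, forall j, exists2 x, A j x & X x} ->
  (size js)%:R <= (2 / s + 3) ^+ d.
Proof.
move=> ujs jsX; rewrite -[2]mulr1; apply: (count_cubes_ball (y := 0) Apart) => //.
move=> j /jsX[x Ax Xx]; exists x => //; rewrite subr0; exact: cubeX_norm_le1.
Qed.

(** Infinitely many far cells would contain a finite family larger than the number of cells that can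
    meet X. *)
Lemma far_cells_seq t : exists js : seq nat, uniq js /\
  forall j, j \in js <-> far_cell t j.
Proof.
have [fin|inf] := pselect (finite_set (far_cell t)).
  exists (finmap.enum_fset (fset_set (far_cell t))); split; first exact: finmap.fset_uniq.
  by move=> j; rewrite in_fset_set//; split => [/set_mem|/mem_set].
have [B BF szB] := infinite_set_fset (Num.trunc ((2 / s + 3) ^+ d)).+1 inf.
exfalso.
have : (size (finmap.enum_fset B))%:R <= (2 / s + 3) ^+ d.
  apply: count_cells_cubeX; first exact: finmap.fset_uniq.
  by move=> j /BF[x [Ax Xx _]]; exists x.
apply/negP; rewrite -ltNge.
have q0 : 0 <= (2 / s + 3) ^+ d by rewrite exprn_ge0// addr_ge0// divr_ge0// ltW.
have /andP[_ h] := truncn_itv q0.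
by apply: lt_le_trans h _; rewrite ler_nat.
Qed.

Lemma sum_cells_le (f : Rd R d -> \bar R) (S : set (Rd R d)) (js : seq nat) :
  uniq js -> measurable S -> measurable_fun S f -> (forall x, S x -> (0 <= f x)%E) ->
  {in js, forall j, A j `&` X `<=` S} ->
  (\sum_(j <- js) \int[PX]_(x in A j `&` X) f x <= \int[PX]_(x in S) f x)%E.
Proof.
move=> ujs mS mf f0 jsS; have [Atriv _ _] := Apart.
have mC j : measurable (A j `&` X : set (Rd R d)).
  by apply: measurableI; [exact: (measurable_cell Apart)|exact: mX].
have US : \big[setU/set0]_(j <- js) (A j `&` X) `<=` S.
  rewrite -bigcup_seq => x [j /= jjs Cx]; exact: jsS Cx.
rewrite -ge0_integral_bigsetU//.
- apply: ge0_subset_integral => //; exact: bigsetU_measurable.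
- by move=> i j _ _ [x [[Ai _] [Aj _]]]; apply: (Atriv i j) => //; exists x.
- exact: (measurable_funS mS US mf).
- by move=> x /US/f0.
Qed.

Lemma sum_cell_mass_le (S : set (Rd R d)) (js : seq nat) (q : R) :
  uniq js -> measurable S -> {in js, forall j, A j `&` X `<=` S} ->
  (PX S <= q%:E)%E -> \sum_(j <- js) cell_mass P A j <= q.
Proof.
move=> ujs mS jsS Sq; rewrite -lee_fin -sumEFin; apply: le_trans Sq.
rewrite -[leRHS]mul1e -integral_cst//.
have cst0 (x : Rd R d) : S x -> (0 <= cst (1%E : \bar R) x)%E by rewrite lee_fin.
apply: le_trans (sum_cells_le ujs mS (measurable_cst _) cst0 jsS).
rewrite le_eqVlt; apply/orP; left; apply/eqP; apply: eq_bigr => j _.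
rewrite -(cell_massE P Apart) integral_cst ?mul1e//.
by apply: measurableI; [exact: (measurable_cell Apart)|exact: mX].
Qed.

Lemma sum_cell_noise_le (S : set (Rd R d)) (js : seq nat) (q : R) :
  uniq js -> measurable S -> S `<=` X -> {in js, forall j, A j `&` X `<=` S} ->
  (\int[PX]_(x in S) noise x <= q%:E)%E -> \sum_(j <- js) cell_noise P eta A j <= q.
Proof.
move=> ujs mS SX jsS Sq; rewrite -lee_fin -sumEFin; apply: le_trans Sq.
have noise0 (x : Rd R d) : S x -> (0 <= `|2 * eta x - 1|%:E)%E by rewrite lee_fin.
have mnoise := measurable_funS mX SX (measurable_noise eta_post).
apply: le_trans (sum_cells_le ujs mS mnoise noise0 jsS).
rewrite le_eqVlt; apply/orP; left; apply/eqP; apply: eq_bigr => j _.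
by rewrite -(cell_noiseE eta_post Apart).
Qed.

Lemma cell_noise_ge j (rho : R) : 0 <= rho ->
  {ae PX, forall x, (A j `&` X) x -> rho <= `|2 * eta x - 1|} ->
  rho * cell_mass P A j <= cell_noise P eta A j.
Proof.
move=> rho0 aeh.
have mC : measurable (A j `&` X : set (Rd R d)).
  by apply: measurableI; [exact: (measurable_cell Apart)|exact: mX].
rewrite -lee_fin EFinM -(cell_massE P Apart) -(cell_noiseE eta_post Apart).
rewrite -integral_cst//; apply: ae_ge0_le_integral => //.
- have CX : A j `&` X `<=` X by move=> x [].
  exact: (measurable_funS mX CX (measurable_noise eta_post)).
Qed.

Section uniform_noise.
Context (rho nu tau eps : R).
Hypotheses (rho_gt0 : 0 < rho)
  (noise_ge : {ae PX, forall x, X x -> rho <= `|2 * eta x - 1|})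
  (nu_ge : (\int[PX]_(x in [set x | X x /\ (Delta eta x < s%:E)%E]) noise x <= nu%:E)%E)
  (eps_ge : nu + expR tau * ((2 / s + 3) ^+ d * (4 / (n%:R * rho))) <= eps).

(** One loss bound holds for all far cells, so it is multiplied by their number. *)
Lemma hist_rule_uniform_noise :
  ((1 - expR (- tau))%:E <= prob_power P n
     [set D | risk P (hist_rule A D) - bayes_risk P <= eps%:E])%E.
Proof.
have [js [ujs jsP]] := far_cells_seq s.
have n0 : 0 < n%:R :> R by rewrite ltr0n.
have nr0 : 0 < 4 / (n%:R * rho) by rewrite divr_gt0// mulr_gt0.
apply: (hist_rule_oracle eta_post Apart n_gt0 (js := js) _ _ _ _ nu_ge eps_ge).
- by move=> j /jsP; exact: far_cell_pure.
- by move=> j x Ax Xx xs; apply/jsP; exists x.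
- by rewrite mulr_gt0// exprn_gt0// ltr_wpDl// divr_ge0// ltW.
- apply: (@le_trans _ _ (\sum_(j <- js) (4 / (n%:R * rho)))).
    rewrite big_seq [leRHS]big_seq; apply: ler_sum => j /jsP jfar.
    have [b jb] := far_cell_pure (lexx s) jfar.
    apply: (cell_loss_le PX1 eta_post Apart n_gt0 jb rho_gt0).
    apply: cell_noise_ge; first exact: ltW.
    by apply: filterS noise_ge => x h [_ /h].
  rewrite big_const_seq count_predT iter_addr_0 -[leLHS]mulr_natl ler_pM2r//.
  by apply: count_cells_cubeX => // j /jsP[x [Ax Xx _]]; exists x.
Qed.

End uniform_noise.

Section layers.
Context (gamma cLC : R).
Hypotheses (gamma_ge0 : 0 <= gamma) (cLC_gt0 : 0 < cLC)
  (LC : controls_noise_below P eta gamma cLC).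

Lemma LC_noise_ge (t : R) : 0 < t -> {ae PX, forall x, X x ->
  (t%:E <= Delta eta x)%E -> t `^ gamma / cLC <= `|2 * eta x - 1|}.
Proof.
move=> t0; apply: filterS LC => x h Xx tx; have {h} := h Xx.
rewrite ler_pdivrMr// mulrC -lee_fin; apply: le_trans.
rewrite -poweR_EFin; apply: gt0_ler_poweR => //; rewrite in_itv/= ?leey ?andbT ?lee_fin ?(ltW t0)//.
exact: Delta_ge0.
Qed.

Lemma far_cell_loss_le t j : s <= t -> far_cell (2 * t) j ->
  loss j <= 4 * cLC / (n%:R * t `^ gamma).
Proof.
move=> st jfar; have t0 : 0 < t by exact: lt_le_trans st.
have s2t := le_double st.
have [b jb] := far_cell_pure s2t jfar.
have rho0 : 0 < t `^ gamma / cLC by rewrite divr_gt0// powR_gt0.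
have -> : 4 * cLC / (n%:R * t `^ gamma) = 4 / (n%:R * (t `^ gamma / cLC)).
  by field; rewrite !gt_eqF ?powR_gt0 ?ltr0n.
apply: (cell_loss_le PX1 eta_post Apart n_gt0 jb rho0).
apply: cell_noise_ge; first exact: ltW.
apply: filterS (LC_noise_ge t0) => x h [Ax Xx]; apply: h => //.
exact: (far_cell_Delta st jfar).
Qed.

Context (K t1 t2 nu EA tau eps : R).
Let N t (js : seq nat) := uniq js ->
  {in js, forall j, exists x, [/\ A j x, X x & (Delta eta x < (2 * t)%:E)%E]} ->
  (size js)%:R <= K * t / s ^+ d.
Hypotheses (K_gt0 : 0 < K) (st1 : s <= t1) (st2 : s <= t2)
  (N_le : forall js, N t2 js)
  (nu_ge : (\int[PX]_(x in [set x | X x /\ (Delta eta x < s%:E)%E]) noise x <= nu%:E)%E)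
  (EA_ge0 : 0 <= EA)
  (EA_ge : forall js, uniq js -> {in js, forall j, far_cell s j /\ ~ far_cell (2 * t1) j} ->
     \sum_(j <- js) loss j <= EA)
  (eps_ge : nu + expR tau * (EA + K * t2 / s ^+ d * (4 * cLC / (n%:R * t1 `^ gamma)) +
     (2 / s + 3) ^+ d * (4 * cLC / (n%:R * t2 `^ gamma))) <= eps).

(** The loss of the innermost cells enters through the parameter [EA], since it is bounded through
    the mass or through the noise depending on the exponents. *)
Lemma hist_rule_layers :
  ((1 - expR (- tau))%:E <= prob_power P n
     [set D | risk P (hist_rule A D) - bayes_risk P <= eps%:E])%E.
Proof.
have [js [ujs jsP]] := far_cells_seq s.
have n0 : 0 < n%:R :> R by rewrite ltr0n.
have c0 (t : R) : s <= t -> 0 < 4 * cLC / (n%:R * t `^ gamma).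
  by move=> st; rewrite divr_gt0 ?mulr_gt0// powR_gt0//; exact: lt_le_trans st.
have t20 : 0 < t2 by exact: lt_le_trans st2.
apply: (hist_rule_oracle eta_post Apart n_gt0 (js := js) _ _ _ _ nu_ge eps_ge).
- by move=> j /jsP; exact: far_cell_pure.
- by move=> j x Ax Xx xs; apply/jsP; exists x.
- rewrite ltr_wpDl// ?addr_ge0//.
    by rewrite mulr_ge0 ?(ltW (c0 _ st1))// divr_ge0 ?exprn_ge0 ?mulr_ge0// ltW.
  by rewrite mulr_gt0 ?(c0 _ st2)// exprn_gt0// ltr_wpDl// divr_ge0// ltW.
pose far t j : bool := `[< far_cell (2 * t) j >].
have farP t j : reflect (far_cell (2 * t) j) (far t j) by exact: asboolP.
(* Outer cells are far at level 2 t2, middle cells only at level 2 t1; the others form the inner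
   layer. *)
rewrite (bigID (far t2)) /= [X in _ + X](bigID (far t1)) /= addrC.
apply: lerD; last first.
  apply: (@le_trans _ _ (\sum_(j <- js | far t2 j) (4 * cLC / (n%:R * t2 `^ gamma)))).
    by apply: ler_sum => j /farP; exact: far_cell_loss_le.
  rewrite -big_filter big_const_seq count_predT iter_addr_0 -[leLHS]mulr_natl ler_pM2r ?c0//.
  apply: count_cells_cubeX; first exact: filter_uniq.
  by move=> j; rewrite mem_filter => /andP[_ /jsP[x [Ax Xx _]]]; exists x.
rewrite addrC; apply: lerD.
  rewrite -big_filter; apply: EA_ge; first exact: filter_uniq.
  move=> j; rewrite mem_filter => /andP[/andP[_ /farP h] /jsP js'].
  by split.
apply: (@le_trans _ _ (\sum_(j <- js | ~~ far t2 j && far t1 j)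
    (4 * cLC / (n%:R * t1 `^ gamma)))).
  by apply: ler_sum => j /andP[_ /farP]; exact: far_cell_loss_le.
rewrite -big_filter big_const_seq count_predT iter_addr_0 -[leLHS]mulr_natl ler_pM2r ?c0//.
apply: N_le; first exact: filter_uniq.
move=> j; rewrite mem_filter => /andP[/andP[/farP h _] /jsP[x [Ax Xx _]]].
exists x; split => //; rewrite ltNge; apply/negP => xt; apply: h.
by exists x.
Qed.

End layers.

Lemma not_far_cell_sub (t : R) j : ~ far_cell t j ->
  A j `&` X `<=` [set x | X x /\ (Delta eta x < t%:E)%E].
Proof.
move=> h x [Ax Xx]; split => //; rewrite ltNge; apply/negP => xt; apply: h.
by exists x.
Qed.

Lemma near_loss_le_noise (t nu : R) (js : seq nat) : uniq js ->
  {in js, forall j, ~ far_cell t j} ->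
  (\int[PX]_(x in [set x | X x /\ (Delta eta x < t%:E)%E]) noise x <= nu%:E)%E ->
  \sum_(j <- js) loss j <= nu.
Proof.
move=> ujs js_near nu_ge.
apply: (@le_trans _ _ (\sum_(j <- js) cell_noise P eta A j)).
  by apply: ler_sum => j _; exact: (cell_loss_le_noise n eta_post Apart).
apply: sum_cell_noise_le ujs _ _ _ nu_ge.
- by apply: measurable_Delta_lt; case: eta_post.
- by move=> x [].
- by move=> j /js_near; exact: not_far_cell_sub.
Qed.

(** [cell_loss_le_split] is summed over disjoint cells: the masses add up to at most q, and the
    remainder is paid once per cell. *)
Lemma near_loss_le_mass (t q lam : R) (js : seq nat) : uniq js -> 0 < lam ->
  {in js, forall j, far_cell s j /\ ~ far_cell t j} ->
  (PX [set x | X x /\ (Delta eta x < t%:E)%E] <= q%:E)%E ->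
  \sum_(j <- js) loss j <= lam * q + (size js)%:R * (4 / (n%:R * lam)).
Proof.
move=> ujs lam0 js_near q_ge.
apply: (@le_trans _ _ (\sum_(j <- js) (lam * cell_mass P A j + 4 / (n%:R * lam)))).
  rewrite big_seq [leRHS]big_seq; apply: ler_sum => j /js_near[/(far_cell_pure (lexx s))[b jb] _].
  exact: (cell_loss_le_split PX1 eta_post Apart n_gt0 jb).
rewrite big_split /= -mulr_sumr; apply: lerD; last first.
  by rewrite big_const_seq count_predT iter_addr_0 -[leLHS]mulr_natl.
rewrite ler_pM2l//; apply: sum_cell_mass_le ujs _ _ q_ge.
- by apply: measurable_Delta_lt; case: eta_post.
- by move=> j /js_near[_]; exact: not_far_cell_sub.
Qed.

End far_cells.

(** * Powers of n and the exponents of the layers *)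

Section rates.
Context (R : realType).

Lemma powR_natD (n : nat) (u v : R) : (0 < n)%N ->
  n%:R `^ u * n%:R `^ v = n%:R `^ (u + v).
Proof.
by move=> n0; rewrite powRD// pnatr_eq0 -lt0n n0 implybT.
Qed.

Lemma powR_nat_inv (n : nat) (e : R) : (0 < n)%N ->
  (n%:R * n%:R `^ e)^-1 = n%:R `^ (- 1 - e).
Proof.
move=> n0; have nE : n%:R = n%:R `^ 1 :> R by rewrite powRr1.
by rewrite [X in X * _]nE powR_natD// -powRN opprD.
Qed.

(** The source of n0: a constant of any size, even one that depends on the boundary, is beaten by a
    negative power of n. The witness comes from |K| <= n^e. *)
Lemma powR_nat_decay (K e : R) : 0 < e ->
  exists n0 : nat, forall n : nat, (n0 <= n)%N -> K * n%:R `^ (- e) <= 1.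
Proof.
move=> e0; have L0 : 0 <= `|K| `^ e^-1 by rewrite powR_ge0.
exists (Num.trunc (`|K| `^ e^-1)).+1 => n nle.
have n0 : (0 < n)%N by exact: leq_trans nle.
have Ln : `|K| `^ e^-1 <= n%:R.
  have /andP[_ h] := truncn_itv L0; apply/ltW/(lt_le_trans h).
  by rewrite ler_nat.
rewrite powRN ler_pdivrMr ?powR_gt0 ?ltr0n// mul1r; apply: le_trans (ler_norm K) _.
have -> : `|K| = (`|K| `^ e^-1) `^ e by rewrite -powRrM mulVf ?gt_eqF// powRr1.
by rewrite ge0_ler_powR// ?nnegrE// ltW.
Qed.

Lemma powR_nat_le1 (n : nat) (u : R) : (0 < n)%N -> 0 <= u -> n%:R `^ (- u) <= 1.
Proof.
move=> n0 u0; rewrite -[leRHS](powRr0 n%:R) ler_powR ?oppr_le0// ler1n.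
exact: n0.
Qed.

Section side_length.
Context (d n : nat) (cs sg : R).
Hypotheses (n_gt0 : (0 < n)%N) (cs_gt0 : 0 < cs) (sg_ge0 : 0 <= sg).
Let s : R := cs * n%:R `^ (- sg).
Let n0 : 0 < n%:R :> R. Proof. by rewrite ltr0n. Qed.

Lemma side_length_gt0 : 0 < s.
Proof. by rewrite mulr_gt0// powR_gt0. Qed.

Lemma side_length_expV : (s ^+ d)^-1 = (cs ^+ d)^-1 * n%:R `^ (d%:R * sg).
Proof.
rewrite /s exprMn -(powR_mulrn _ (powR_ge0 _ _)) -powRrM mulNr powRN invfM invrK.
by rewrite (mulrC sg).
Qed.

(** As s <= cs, the summand 3 is at most 3 cs / s. *)
Lemma cell_count_rate :
  (2 / s + 3) ^+ d <= ((2 + 3 * cs) / cs) ^+ d * n%:R `^ (d%:R * sg).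
Proof.
have s0 := side_length_gt0.
have scs : s <= cs by rewrite /s ler_piMr ?(ltW cs_gt0)// powR_nat_le1.
rewrite expr_div_n -mulrA -side_length_expV -expr_div_n.
apply: lerXn2r; rewrite ?nnegrE.
- by rewrite addr_ge0// divr_ge0// ltW.
- by rewrite divr_ge0 ?(ltW s0)// addr_ge0// mulr_ge0// ltW.
by rewrite ler_pdivlMr// mulrDl divfK ?gt_eqF// lerD2l ler_pM2l.
Qed.

Lemma powR_scale (c u e : R) : 0 <= c -> (c * n%:R `^ (- u)) `^ e = c `^ e * n%:R `^ (- (e * u)).
Proof. by move=> c0; rewrite powRM ?powR_ge0// -powRrM mulNr (mulrC u). Qed.

Lemma uniform_rate (r Cnu rho tau : R) : 0 < rho -> 1 - d%:R * sg = r ->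
  Cnu * n%:R `^ (- r) + expR tau * ((2 / s + 3) ^+ d * (4 / (n%:R * rho))) <=
  (Cnu + expR tau * (((2 + 3 * cs) / cs) ^+ d * (4 / rho))) * n%:R `^ (- r).
Proof.
move=> rho0 rE; rewrite [leRHS]mulrDl lerD2l -[leRHS]mulrA ler_pM2l ?expR_gt0//.
apply: (@le_trans _ _ (((2 + 3 * cs) / cs) ^+ d * n%:R `^ (d%:R * sg) * (4 / (n%:R * rho)))).
  by rewrite ler_pM2r ?cell_count_rate// divr_gt0// mulr_gt0.
rewrite le_eqVlt; apply/orP; left; apply/eqP.
have -> : n%:R `^ (- r) = n%:R `^ (d%:R * sg) / n%:R.
  by rewrite -[X in _ / X]powRr1// -powRN powR_natD// -rE; congr (_ `^ _); ring.
by field; rewrite !gt_eqF.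
Qed.

End side_length.

Section layer_exponents.
Context (d : nat) (a b g cs cLC cME K : R).
Hypotheses (a_gt0 : 0 < a) (b_gt0 : 0 < b) (g_gt0 : 0 < g) (cs_gt0 : 0 < cs)
  (cLC_gt0 : 0 < cLC) (cME_gt0 : 0 < cME) (K_gt0 : 0 < K).
Let k := (1 + g) * (a + g).
Hypothesis bg_le : b * g <= k.
Let F := b * (k + g ^+ 2) + d%:R * k.
Let sg := k / F.
Let r := b * k / F.
(* [1 + g - 1 / (2 (1 + a))] lies strictly between the two bounds that the
   inner and the middle layer impose on the exponent of [t1]. *)
Let x0 := b * (1 + g - (2 * (1 + a))^-1).
(** The cap k yields x <= sg, which keeps t1 above the side length. *)
Let x := Num.min x0 k / F.
(** The solution of 1 - d sg = r + g y, so that the outer layer attains the rate; y <= sg is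
    [bg_le]. *)
Let y := b * g / F.

Definition inner_exponent : R := x.
Definition outer_exponent : R := y.

Let k_gt0 : 0 < k. Proof. by rewrite mulr_gt0// addr_gt0. Qed.
Let F_gt0 : 0 < F.
Proof.
apply: ltr_wpDr; first by rewrite mulr_ge0// ltW.
by rewrite mulr_gt0// addr_gt0// exprn_gt0.
Qed.
Let x0_gt0 : 0 < x0.
Proof.
rewrite mulr_gt0//.
have : (2 * (1 + a))^-1 < 1 by rewrite invf_lt1; move: a_gt0; lra.
by move: g_gt0; lra.
Qed.

Lemma inner_exponent_gt0 : 0 < x.
Proof. by rewrite divr_gt0// lt_min x0_gt0 k_gt0. Qed.

Lemma outer_exponent_gt0 : 0 < y.
Proof. by rewrite divr_gt0// mulr_gt0. Qed.

Lemma inner_exponent_le : x <= sg.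
Proof. by rewrite ler_pM2r ?invr_gt0// ge_min lexx orbT. Qed.

Lemma outer_exponent_le : y <= sg.
Proof. by rewrite ler_pM2r ?invr_gt0. Qed.

Lemma side_exponent_balance : 1 - d%:R * sg = r + g * y.
Proof. by rewrite /sg /r /y /F; field; rewrite gt_eqF. Qed.

Lemma rate_side_exponent : b * sg = r.
Proof. by rewrite /sg /r mulrA. Qed.

Lemma middle_gap_gt0 : 0 < y + g * y - g * x.
Proof.
have -> : y + g * y - g * x = g * (b * (1 + g) - Num.min x0 k) / F.
  by rewrite /x /y; ring.
rewrite divr_gt0// mulr_gt0// subr_gt0; apply: (@le_lt_trans _ _ x0).
  by rewrite ge_min lexx.
rewrite /x0 ltr_pM2l//.
have : 0 < (2 * (1 + a))^-1 by rewrite invr_gt0 mulr_gt0// addr_gt0.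
by lra.
Qed.

(** At x = x0 / F the gap equals b / (2 F): the room gained by subtracting only half of 1/(1 +
    a). *)
Lemma inner_gap_gt0 : x0 <= k -> 0 < (1 + a) * x + g * y - r.
Proof.
move=> x0k; have -> : (1 + a) * x + g * y - r = b / 2 / F.
  rewrite /x min_l// /x0 /y /r /k.
  by field; rewrite !gt_eqF//; move: a_gt0; lra.
by rewrite !divr_gt0.
Qed.

(** In this case t1 is of the order of s, and the margin-noise exponent bounds the inner layer. *)
Lemma inner_exponentE : k < x0 -> x = sg.
Proof. by move=> kx; rewrite /x min_r// ltW. Qed.

Let t1 n : R := (1 + cs) * n%:R `^ (- x).
Let t2 n : R := (1 + cs) * n%:R `^ (- y).
Let s n : R := cs * n%:R `^ (- sg).
Let sg_ge0 : 0 <= sg. Proof. by rewrite divr_ge0// ltW. Qed.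

(** The factor 1 + cs serves twice: it exceeds cs, which puts s below the scale, and it exceeds 1,
    so powers of the scale dominate pure powers of n. *)
Lemma side_le_scale n u : (0 < n)%N -> u <= sg -> s n <= (1 + cs) * n%:R `^ (- u).
Proof.
move=> n0 usg; apply: ler_pM; rewrite ?powR_ge0 ?(ltW cs_gt0)//.
  by rewrite lerDr.
by rewrite ler_powR ?ler1n// lerN2.
Qed.

Let cs1 : 0 < 1 + cs. Proof. by rewrite addr_gt0. Qed.

Lemma outer_layer_rate n : (0 < n)%N ->
  (2 / s n + 3) ^+ d * (4 * cLC / (n%:R * t2 n `^ g)) <=
  ((2 + 3 * cs) / cs) ^+ d * (4 * cLC) * n%:R `^ (- r).
Proof.
move=> n0; have nR : 0 < n%:R :> R by rewrite ltr0n.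
have M0 : 0 <= ((2 + 3 * cs) / cs) ^+ d.
  by rewrite exprn_ge0// divr_ge0 ?(ltW cs_gt0)// addr_ge0// mulr_ge0// ltW.
have t2g : n%:R `^ (- (g * y)) <= t2 n `^ g.
  rewrite /t2 powR_scale ?(ltW cs1)// ler_peMl ?powR_ge0//.
  by rewrite -[leLHS](powRr0 (1 + cs)) ler_powR ?(ltW g_gt0)// lerDl ltW.
have t2g0 : 0 < n%:R `^ (- (g * y)) by rewrite powR_gt0.
apply: (@le_trans _ _ (((2 + 3 * cs) / cs) ^+ d * n%:R `^ (d%:R * sg) *
    (4 * cLC / (n%:R * n%:R `^ (- (g * y)))))).
  apply: ler_pM.
  - by rewrite exprn_ge0// addr_ge0// divr_ge0// ltW// side_length_gt0.
  - by rewrite divr_ge0 ?mulr_ge0 ?powR_ge0 ?(ltW cLC_gt0).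
  - exact: cell_count_rate.
  - rewrite ler_pM2l ?mulr_gt0// lef_pV2 ?posrE ?mulr_gt0//; last exact: lt_le_trans t2g.
    by rewrite ler_pM2l.
rewrite le_eqVlt; apply/orP; left; apply/eqP.
have -> : n%:R `^ (- r) = n%:R `^ (d%:R * sg) * (n%:R * n%:R `^ (- (g * y)))^-1.
  rewrite powR_nat_inv// powR_natD//; congr (_ `^ _).
  by have := side_exponent_balance; lra.
by ring.
Qed.

Lemma middle_layer_rate n : (0 < n)%N ->
  K * t2 n / s n ^+ d * (4 * cLC / (n%:R * t1 n `^ g)) <=
  K * (1 + cs) / cs ^+ d * (4 * cLC) * n%:R `^ (- (y + g * y - g * x)) * n%:R `^ (- r).
Proof.
move=> n0; have nR : 0 < n%:R :> R by rewrite ltr0n.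
have t1g : n%:R `^ (- (g * x)) <= t1 n `^ g.
  rewrite /t1 powR_scale ?(ltW cs1)// ler_peMl ?powR_ge0//.
  by rewrite -[leLHS](powRr0 (1 + cs)) ler_powR ?(ltW g_gt0)// lerDl ltW.
have t1g0 : 0 < n%:R `^ (- (g * x)) by rewrite powR_gt0.
apply: (@le_trans _ _ (K * t2 n / s n ^+ d * (4 * cLC / (n%:R * n%:R `^ (- (g * x)))))).
  rewrite ler_pM2l; last first.
    by rewrite divr_gt0 ?exprn_gt0 ?side_length_gt0// !mulr_gt0// powR_gt0.
  rewrite ler_pM2l ?mulr_gt0// lef_pV2 ?posrE ?mulr_gt0//; last exact: lt_le_trans t1g.
  by rewrite ler_pM2l.
rewrite (side_length_expV d n cs sg).
rewrite le_eqVlt; apply/orP; left; apply/eqP.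
rewrite -[in RHS]mulrA powR_natD//.
have -> : - (y + g * y - g * x) + - r = - y + d%:R * sg - 1 + g * x.
  by have := side_exponent_balance; lra.
have -> : (n%:R * n%:R `^ (- (g * x)))^-1 = n%:R `^ (-1 + g * x).
  by rewrite powR_nat_inv//; congr (_ `^ _); ring.
rewrite /t2 -!addrA -(@powR_natD n (- y))// -(@powR_natD n (d%:R * sg))//.
by ring.
Qed.

(** The weight lam = n^(-r + a x) brings lam (2 cME t1)^a exactly to the order n^-r; the term with
    the cell count keeps the gap as an extra negative power of n. *)
Lemma inner_layer_rate n (N : R) : (0 < n)%N -> x0 <= k ->
  N <= K * t1 n / s n ^+ d ->
  n%:R `^ (- r + a * x) * (cME * (2 * t1 n)) `^ a + N * (4 / (n%:R * n%:R `^ (- r + a * x))) <=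
  ((2 * cME * (1 + cs)) `^ a +
    K * (1 + cs) / cs ^+ d * 4 * n%:R `^ (- ((1 + a) * x + g * y - r))) * n%:R `^ (- r).
Proof.
move=> n0 x0k NK; have nR : 0 < n%:R :> R by rewrite ltr0n.
rewrite [leRHS]mulrDl; apply: lerD.
  have -> : cME * (2 * t1 n) = (2 * cME * (1 + cs)) * n%:R `^ (- x) by rewrite /t1; ring.
  rewrite powR_scale ?mulr_ge0 ?(ltW cME_gt0) ?(ltW cs1)// mulrCA powR_natD//.
  by rewrite addrK.
apply: (@le_trans _ _ (K * t1 n / s n ^+ d * (4 / (n%:R * n%:R `^ (- r + a * x))))).
  by rewrite ler_pM2r// divr_gt0// mulr_gt0// powR_gt0.
rewrite (side_length_expV d n cs sg).
rewrite le_eqVlt; apply/orP; left; apply/eqP.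
rewrite -[in RHS]mulrA powR_natD//.
have -> : - ((1 + a) * x + g * y - r) + - r = - x + (d%:R * sg + (- 1 + (r - a * x))).
  by have := side_exponent_balance; lra.
have -> : (n%:R * n%:R `^ (- r + a * x))^-1 = n%:R `^ (-1 + (r - a * x)).
  by rewrite powR_nat_inv//; congr (_ `^ _); ring.
rewrite /t1 -(@powR_natD n (- x))// -(@powR_natD n (d%:R * sg))//.
by ring.
Qed.

End layer_exponents.
End rates.

(** * Zero and infinite exponents *)

Section exponents.
Context (R : realType) (d : nat) (P : probability (XY R d) R) (eta : Rd R d -> R).
Hypothesis eta_post : is_posterior P eta.
Local Notation X := (cubeX R d).
Local Notation PX := (marginal P).
Local Notation noise := (fun x => `|2 * eta x - 1|%:E).

(** The power 0 of [Delta] is 1 even where [Delta] is 0 or infinite. *)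
Lemma LC0_noise_ge (cLC : R) : 0 < cLC -> controls_noise_below P eta 0 cLC ->
  {ae PX, forall x, X x -> cLC^-1 <= `|2 * eta x - 1|}.
Proof.
move=> cLC0 LC; apply: filterS LC => x h Xx; have {h} := h Xx.
by rewrite poweRe0 lee_fin -ler_pdivrMl// mulr1.
Qed.

(** At t = 1/(2 cME) the base of the infinite power is 1/2, so the power is 0 and [Delta] >= t
    almost everywhere. *)
Lemma ME_infty_noise_ge (gamma cME cLC : R) : 0 <= gamma -> 0 < cME -> 0 < cLC ->
  controls_noise_below P eta gamma cLC -> has_ME P eta +oo%E cME ->
  {ae PX, forall x, X x -> ((2 * cME)^-1) `^ gamma / cLC <= `|2 * eta x - 1|}.
Proof.
move=> g0 cME0 cLC0 LC ME.
have t0 : 0 < (2 * cME)^-1 by rewrite invr_gt0 mulr_gt0.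
have meta : measurable_fun X eta by case: eta_post.
have far : {ae PX, forall x, X x -> ((2 * cME)^-1%:E <= Delta eta x)%E}.
  have mS := measurable_Delta_lt meta (2 * cME)^-1.
  have : PX.-negligible [set x | X x /\ (Delta eta x < (2 * cME)^-1%:E)%E].
    apply/(negligibleP _ mS).2; apply/eqP; rewrite eq_le measure_ge0 andbT.
    apply: le_trans (ME _ t0) _; rewrite /powRe.
    have -> : cME * (2 * cME)^-1 = 2^-1 by field; rewrite gt_eqF.
    by rewrite invf_lt1// ltr1n.
  apply: negligibleS => x /= /not_implyP[Xx /negP]; rewrite -ltNge => h.
  by split.
apply: (filterS2 _ _ far (LC_noise_ge g0 cLC0 LC t0)) => x hfar h Xx.
exact: (h Xx (hfar Xx)).
Qed.

(** At t = 1/cMNE the base is 1 and the hypothesis only gives the bound 1. The bound 0 holds at each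
    t_k below 1/cMNE and passes to the union by monotone convergence. *)
Lemma MNE_infty_near (cMNE : R) : 0 < cMNE -> has_MNE P eta +oo%E cMNE ->
  (\int[PX]_(x in [set x | X x /\ (Delta eta x < cMNE^-1%:E)%E]) noise x <= 0)%E.
Proof.
move=> c0 MNE; have meta : measurable_fun X eta by case: eta_post.
pose t (k : nat) : R := cMNE^-1 * (1 - k.+2%:R^-1).
have tlt k : t k < cMNE^-1.
  by rewrite gtr_pMr ?invr_gt0// ltrBlDr ltrDl invr_gt0 ltr0n.
have tgt k : 0 < t k by rewrite mulr_gt0 ?invr_gt0// subr_gt0 invf_lt1 ?ltr1n// ltr0n.
pose F k : set (Rd R d) := [set x | X x /\ (Delta eta x < (t k)%:E)%E].
have FU : \bigcup_k F k = [set x | X x /\ (Delta eta x < cMNE^-1%:E)%E].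
  apply/seteqP; split=> x.
    by move=> [k _ [Xx xt]]; split => //; apply: lt_trans xt _; rewrite lte_fin.
  move=> [Xx xt]; have D0 := Delta_ge0 eta Xx.
  have DE : Delta eta x = (fine (Delta eta x))%:E.
    by rewrite fineK// ge0_fin_numE//; apply: lt_le_trans xt _; rewrite leey.
  rewrite DE lte_fin in xt; set e := fine _ in DE xt.
  have u0 : 0 < 1 - e * cMNE by rewrite subr_gt0 -ltr_pdivlMr// mul1r.
  (* This k satisfies 1/(k + 2) < 1 - e cMNE, that is e < t_k. *)
  exists (Num.trunc (1 - e * cMNE)^-1) => //; split => //; rewrite DE lte_fin /t.
  rewrite mulrC ltr_pdivlMr// ltrBrDr -ltrBrDl.
  rewrite -[ltRHS]invrK ltf_pV2 ?posrE ?invr_gt0 ?ltr0n//.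
  have v0 : 0 <= (1 - e * cMNE)^-1 by rewrite invr_ge0 ltW.
  have /andP[_ h] := truncn_itv v0.
  by apply: lt_trans h _; rewrite ltr_nat.
have mF k : measurable (F k) by exact: measurable_Delta_lt.
have mnoise k : measurable_fun (F k) noise.
  apply: (measurable_funS (@measurable_cubeX R d) _ (measurable_noise eta_post)).
  by move=> x [].
rewrite -FU.
apply: (cvge_to_le (ge0_nondecreasing_set_cvg_integral (F := F) (f := noise) _ mF mnoise _)).
- move=> i j ij; apply/subsetPset => x [Xx xt]; split => //; apply: lt_le_trans xt _.
  rewrite lee_fin ler_pM2l ?invr_gt0// lerD2l lerN2 lef_pV2 ?posrE ?ltr0n//.
  by rewrite ler_nat !ltnS.
- by move=> i x _; rewrite lee_fin.
- apply: nearW => k; apply: le_trans (MNE _ (tgt k)) _; rewrite /powRe.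
  by rewrite -ltr_pdivlMl// mulr1 tlt.
Qed.

End exponents.

(** * Rate when the noise is bounded below almost everywhere *)

Section case_uniform.
Context (R : realType) (d : nat).

Lemma rate_uniform (cs sg r Cnu rho tau : R) :
  0 < cs -> 0 <= sg -> 0 < rho -> 0 <= Cnu -> 1 - d%:R * sg = r ->
  exists c : R, 0 < c /\
  forall (P : probability (XY R d) R) (eta : Rd R d -> R),
    on_cubeX P -> is_posterior P eta ->
    Xzero eta = rel_boundary (cubeX R d) (Xpos eta) ->
    Xzero eta = rel_boundary (cubeX R d) (Xneg eta) ->
    {ae marginal P, forall x, cubeX R d x -> rho <= `|2 * eta x - 1|} ->
  forall n : nat, (0 < n)%N ->
  (\int[marginal P]_(x in [set x | cubeX R d x /\ (Delta eta x < (cs * n%:R `^ (- sg))%:E)%E])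
     `|2 * eta x - 1|%:E <= (Cnu * n%:R `^ (- r))%:E)%E ->
  forall A : nat -> set 'rV[R]_d, cube_partition (cs * n%:R `^ (- sg)) A ->
  ((1 - expR (- tau))%:E <= prob_power P n
     [set D | risk P (hist_rule A D) - bayes_risk P <= (c * n%:R `^ (- r))%:E])%E.
Proof.
move=> cs0 sg0 rho0 Cnu0 rE.
exists (Cnu + expR tau * (((2 + 3 * cs) / cs) ^+ d * (4 / rho))); split.
  rewrite ltr_wpDl// mulr_gt0 ?expR_gt0// mulr_gt0 ?divr_gt0// exprn_gt0// divr_gt0//.
  by rewrite addr_gt0// mulr_gt0.
move=> P eta PX1 eta_post bdpos bdneg noise_ge n n0 nu_ge A Apart.
apply: (hist_rule_uniform_noise PX1 eta_post bdpos bdneg Apart n0 _ rho0 noise_ge nu_ge).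
  exact: side_length_gt0.
exact: uniform_rate.
Qed.

End case_uniform.

(** * Rate from the three layers *)

Section case_layers.
Context (R : realType) (d : nat).

Lemma rate_layers (a b g cs cLC cME cMNE tau : R) :
  0 < a -> 0 < b -> 0 < g -> 0 < cs -> 0 < cLC -> 0 < cME -> 0 < cMNE ->
  let k := (1 + g) * (a + g) in
  let F := b * (k + g ^+ 2) + d%:R * k in
  b * g <= k ->
  exists c : R, 0 < c /\
  forall X0 : set 'rV[R]_d, rectifiable d.-1 X0 ->
  exists n0 : nat,
  forall (P : probability (XY R d) R) (eta : Rd R d -> R),
    on_cubeX P -> is_posterior P eta ->
    controls_noise_below P eta g cLC ->
    has_MNE P eta b%:E cMNE -> has_ME P eta a%:E cME ->
    Xzero eta = X0 ->
    Xzero eta = rel_boundary (cubeX R d) (Xpos eta) ->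
    Xzero eta = rel_boundary (cubeX R d) (Xneg eta) ->
  forall n : nat, (n0 <= n)%N ->
  forall A : nat -> set 'rV[R]_d, cube_partition (cs * n%:R `^ (- (k / F))) A ->
  ((1 - expR (- tau))%:E <= prob_power P n
     [set D | risk P (hist_rule A D) - bayes_risk P <= (c * n%:R `^ (- (b * k / F)))%:E])%E.
Proof.
move=> a0 b0 g0 cs0 cLC0 cME0 cMNE0 k F bgk.
set sg := k / F; set r := b * k / F.
pose x := inner_exponent d a b g; pose y := outer_exponent d a b g.
have x_gt0 : 0 < x by exact: inner_exponent_gt0.
have y_gt0 : 0 < y by exact: outer_exponent_gt0.
have gapB : 0 < y + g * y - g * x by exact: middle_gap_gt0.
have x_le : x <= sg by exact: inner_exponent_le.
have y_le : y <= sg by exact: outer_exponent_le.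
have sg0 : 0 <= sg by apply: le_trans x_le; exact: ltW.
have bsg : b * sg = r by exact: rate_side_exponent.
(* Covers both treatments of the inner layer: the first summand that by noise, the others that by
   mass, where 1 bounds the term containing K. *)
pose CA := (2 * cMNE * (1 + cs)) `^ b + ((2 * cME * (1 + cs)) `^ a + 1).
pose CC := ((2 + 3 * cs) / cs) ^+ d * (4 * cLC).
have CA0 : 0 <= CA by rewrite !addr_ge0 ?powR_ge0.
have CC0 : 0 < CC.
  by rewrite mulr_gt0 ?mulr_gt0// exprn_gt0// divr_gt0// addr_gt0// mulr_gt0.
(* K is not yet available; the extra 1 stands for the middle layer, which is at most n^-r once n >=
   n3. *)
exists ((cMNE * cs) `^ b + expR tau * (CA + 1 + CC)); split.
  by rewrite ltr_wpDl ?powR_ge0// mulr_gt0 ?expR_gt0// ltr_wpDl// addr_ge0.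
move=> X0 X0rect; have [K K0 count] := count_near_boundary X0rect.
pose x0 := b * (1 + g - (2 * (1 + a))^-1).
(* n1 and n2 bring t1 and t2 below 1, as the count near the boundary requires. *)
have [n1 n1P] := powR_nat_decay (1 + cs) x_gt0.
have [n2 n2P] := powR_nat_decay (1 + cs) y_gt0.
have [n3 n3P] := powR_nat_decay (K * (1 + cs) / cs ^+ d * (4 * cLC)) gapB.
have [n4 n4P] : exists n4 : nat, x0 <= k -> forall n : nat, (n4 <= n)%N ->
    K * (1 + cs) / cs ^+ d * 4 * n%:R `^ (- ((1 + a) * x + g * y - r)) <= 1.
  have [x0k|x0k] := leP x0 k; last by exists 0%N.
  have gapA : 0 < (1 + a) * x + g * y - r by exact: inner_gap_gt0.
  by have [n4 n4P] := powR_nat_decay (K * (1 + cs) / cs ^+ d * 4) gapA; exists n4.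
exists (maxn 1 (maxn n1 (maxn n2 (maxn n3 n4)))).
move=> P eta PX1 eta_post LC MNE ME etaX0 bdpos bdneg n.
rewrite !geq_max => /andP[n_gt0 /andP[n1n /andP[n2n /andP[n3n n4n]]]] A Apart.
have s0 : 0 < cs * n%:R `^ (- sg) by exact: side_length_gt0.
set s := cs * n%:R `^ (- sg) in Apart s0.
pose t1 := (1 + cs) * n%:R `^ (- x); pose t2 := (1 + cs) * n%:R `^ (- y).
have st1 : s <= t1 by exact: side_le_scale.
have st2 : s <= t2 by exact: side_le_scale.
have t1_gt0 : 0 < t1 by exact: lt_le_trans st1.
have Nr0 : 0 <= n%:R `^ (- r) :> R by rewrite powR_ge0.
have nu_ge : (\int[marginal P]_(x in [set x | cubeX R d x /\ (Delta eta x < s%:E)%E])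
    `|2 * eta x - 1|%:E <= ((cMNE * cs) `^ b * n%:R `^ (- r))%:E)%E.
  apply: le_trans (MNE _ s0) _.
  by rewrite /powRe /s mulrA powR_scale ?mulr_ge0 ?(ltW cMNE0) ?(ltW cs0)// bsg.
apply: (hist_rule_layers PX1 eta_post bdpos bdneg Apart n_gt0 s0 (ltW g0) cLC0 LC K0 st1 st2
  (EA := CA * n%:R `^ (- r)) _ nu_ge).
- by move=> js ujs; apply: (count eta A) => //; exact: n2P.
- by rewrite mulr_ge0.
(* If k < x0, then x = sg and b x = r, so the noise gives the rate; otherwise the mass is used. *)
- move=> js ujs js_near; have [x0k|x0k] := leP x0 k; last first.
    apply: (@le_trans _ _ ((2 * cMNE * (1 + cs)) `^ b * n%:R `^ (- r))); last first.
      by rewrite ler_wpM2r// lerDl addr_ge0// powR_ge0.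
    apply: (near_loss_le_noise n eta_post Apart (t := 2 * t1)) => //.
      by move=> j /js_near[].
    apply: le_trans (MNE _ _) _; first by rewrite mulr_gt0.
    rewrite /powRe /t1 (_ : cMNE * _ = 2 * cMNE * (1 + cs) * n%:R `^ (- x)); last by ring.
    rewrite powR_scale ?mulr_ge0 ?(ltW cMNE0) ?addr_ge0 ?(ltW cs0)//.
    by rewrite (_ : b * x = r)// -bsg; congr (_ * _); exact: inner_exponentE.
  have lam0 : 0 < n%:R `^ (- r + a * x) :> R by rewrite powR_gt0 ?ltr0n.
  have t1_2 : 0 < 2 * t1 by rewrite mulr_gt0.
  apply: le_trans (near_loss_le_mass PX1 eta_post bdpos bdneg Apart n_gt0 s0
    ujs lam0 js_near (ME _ t1_2)) _.
  have szjs : (size js)%:R <= K * t1 / s ^+ d.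
    apply: (count eta A) => //; first exact: n1P.
    move=> j /js_near[[z [Az Xz _]] h]; exists z; split => //.
    by rewrite ltNge; apply/negP => hz; apply: h; exists z.
  apply: le_trans (inner_layer_rate a0 b0 g0 cs0 cME0 n_gt0 x0k szjs) _.
  rewrite ler_wpM2r// /CA -[leLHS]add0r; apply: lerD; rewrite ?powR_ge0// lerD2l.
  exact: n4P.
- rewrite [leRHS]mulrDl lerD2l -[leRHS]mulrA ler_pM2l ?expR_gt0//
    (mulrDl (CA + 1)) (mulrDl CA) mul1r.
  apply: lerD; last exact: outer_layer_rate.
  rewrite lerD2l; apply: le_trans (middle_layer_rate d a0 b0 g0 cs0 cLC0 K0 n_gt0) _.
  by rewrite ler_piMl//; exact: n3P.
Qed.

End case_layers.

(** * Assembly of the cases of finite, infinite and zero exponents *)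

Theorem theorem3p6 (R : realType) (d : nat) (alpha beta : \bar R)
  (gamma tau cME cMNE cLC h : R)
  (alpha_gt0 : (0 < alpha)%E) (beta_gt0 : (0 < beta)%E) (gamma_ge0 : 0 <= gamma)
  (tau_ge1 : 1 <= tau)
  (cME_gt0 : 0 < cME) (cMNE_gt0 : 0 < cMNE) (cLC_gt0 : 0 < cLC) (h_gt0 : 0 < h)
  (beta_le : (beta <= gamma%:E^-1 * kappa alpha gamma)%E) :
  exists c : R, 0 < c /\
  forall X0 : set 'rV[R]_d,
    hausdorff d.-1 X0 = h%:E -> rectifiable d.-1 X0 ->
  exists n0 : nat,
  forall (P : probability (XY R d) R) (eta : Rd R d -> R),
    on_cubeX P -> is_posterior P eta ->
    controls_noise_below P eta gamma cLC ->
    has_MNE P eta beta cMNE -> has_ME P eta alpha cME ->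
    Xzero eta = X0 ->
    X0 = rel_boundary (cubeX R d) (Xpos eta) ->
    X0 = rel_boundary (cubeX R d) (Xneg eta) ->
  forall n : nat, (n0 <= n)%N ->
  forall A : nat -> set 'rV[R]_d,
    cube_partition (side d alpha beta gamma tau cME cMNE cLC h n) A ->
  ((1 - 2 * expR (- tau))%:E <=
   prob_power P n
     [set D | risk P (hist_rule A D) - bayes_risk P <=
              (c * n%:R `^ (- rate_exponent d alpha beta gamma))%:E])%E.
Proof.
have tau_le : ((1 - 2 * expR (- tau))%:E <= (1 - expR (- tau))%:E)%E.
  by rewrite lee_fin lerD2l lerN2 ler_peMl ?expR_ge0// ler1n.
set cs := c_side d alpha beta gamma tau cME cMNE cLC h.
set sg := side_exponent d alpha beta gamma.
set r := rate_exponent d alpha beta gamma.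
have sideE n : side d alpha beta gamma tau cME cMNE cLC h n = cs * n%:R `^ (- sg) by [].
(* A nonpositive side admits no partition, as d > 0 by rectifiability, so the claim is then
   vacuous. *)
have [cs0|cs0] := ltP 0 cs; last first.
  exists 1; split => // X0 _ X0rect; exists 0%N => P eta _ _ _ _ _ _ _ _ n _ A.
  have d0 : (0 < d)%N by rewrite (leq_trans X0rect.1)// leq_pred.
  move=> /(cube_partition_gt0 d0); rewrite sideE ltNge => /negP[].
  by rewrite mulr_le0_ge0// powR_ge0.
(* Shared by all cases with noise bounded below almost everywhere; there n0 = 1 works for every
   boundary. *)
have uniform (Cnu rho : R) : 0 < rho -> 0 <= sg -> 1 - d%:R * sg = r -> 0 <= Cnu ->
    (forall (P : probability (XY R d) R) (eta : Rd R d -> R), is_posterior P eta ->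
      controls_noise_below P eta gamma cLC -> has_ME P eta alpha cME ->
      {ae marginal P, forall x, cubeX R d x -> rho <= `|2 * eta x - 1|}) ->
    (forall (P : probability (XY R d) R) (eta : Rd R d -> R) (n : nat), (0 < n)%N ->
      is_posterior P eta -> has_MNE P eta beta cMNE ->
      (\int[marginal P]_(x in [set x | cubeX R d x /\ (Delta eta x < (cs * n%:R `^ (- sg))%:E)%E])
        `|2 * eta x - 1|%:E <= (Cnu * n%:R `^ (- r))%:E)%E) ->
    exists c : R, 0 < c /\
    forall X0 : set 'rV[R]_d,
      hausdorff d.-1 X0 = h%:E -> rectifiable d.-1 X0 ->
    exists n0 : nat,
    forall (P : probability (XY R d) R) (eta : Rd R d -> R),
      on_cubeX P -> is_posterior P eta ->
      controls_noise_below P eta gamma cLC ->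
      has_MNE P eta beta cMNE -> has_ME P eta alpha cME ->
      Xzero eta = X0 ->
      X0 = rel_boundary (cubeX R d) (Xpos eta) ->
      X0 = rel_boundary (cubeX R d) (Xneg eta) ->
    forall n : nat, (n0 <= n)%N ->
    forall A : nat -> set 'rV[R]_d,
      cube_partition (side d alpha beta gamma tau cME cMNE cLC h n) A ->
    ((1 - 2 * expR (- tau))%:E <= prob_power P n
       [set D | risk P (hist_rule A D) - bayes_risk P <= (c * n%:R `^ (- r))%:E])%E.
  move=> rho0 sg0 rE Cnu0 noise_ge nu_ge.
  have [c [c0 cP]] := @rate_uniform R d cs sg r Cnu rho tau cs0 sg0 rho0 Cnu0 rE.
  exists c; split => // X0 _ _; exists 1%N.
  move=> P eta PX1 eta_post LC MNE ME <- bdpos bdneg n n0 A Apart.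
  apply: le_trans tau_le _; apply: (cP P eta) => //; first exact: noise_ge.
  exact: nu_ge.
have MNE_fin (b : R) (P : probability (XY R d) R) (eta : Rd R d -> R) (n : nat) :
    b * sg = r -> (0 < n)%N -> has_MNE P eta b%:E cMNE ->
    (\int[marginal P]_(x in [set x | cubeX R d x /\ (Delta eta x < (cs * n%:R `^ (- sg))%:E)%E])
      `|2 * eta x - 1|%:E <= ((cMNE * cs) `^ b * n%:R `^ (- r))%:E)%E.
  move=> bsg n0 MNE; apply: le_trans (MNE _ _) _; first exact: side_length_gt0.
  by rewrite /powRe mulrA powR_scale ?mulr_ge0 ?(ltW cMNE_gt0) ?(ltW cs0)// bsg.
have dn0 (b : R) : 0 < b -> 0 < b + d%:R by move=> b0; rewrite ltr_wpDr.
have rho_gt0 : 0 < ((2 * cME)^-1) `^ gamma / cLC.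
  by rewrite divr_gt0// powR_gt0// invr_gt0 mulr_gt0.
have real_or_infty (u : \bar R) : (0 < u)%E -> (exists v : R, 0 < v /\ u = v%:E) \/ u = +oo%E.
  by case: u => // [v v0|_]; [left; exists v|right].
have [[a [a0 alphaE]]|alphaE] := real_or_infty _ alpha_gt0; last first.
  have noise_ge (P : probability (XY R d) R) (eta : Rd R d -> R) : is_posterior P eta ->
      controls_noise_below P eta gamma cLC -> has_ME P eta alpha cME ->
      {ae marginal P, forall x, cubeX R d x ->
        ((2 * cME)^-1) `^ gamma / cLC <= `|2 * eta x - 1|}.
    by rewrite alphaE => eta_post LC ME; exact: ME_infty_noise_ge LC ME.
  have [[b [b0 betaE]]|betaE] := real_or_infty _ beta_gt0.
    apply: (uniform ((cMNE * cs) `^ b) _ rho_gt0 _ _ _ noise_ge) => //.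
    - by rewrite /sg /side_exponent alphaE betaE invr_ge0 ltW// dn0.
    - by rewrite /sg /r /side_exponent /rate_exponent alphaE betaE; field; rewrite gt_eqF// dn0.
    - exact: powR_ge0.
    - rewrite betaE => P eta n n0 _; apply: MNE_fin => //.
      by rewrite /sg /r /side_exponent /rate_exponent alphaE betaE.
  (* For beta = oo the side is the constant 1/cMNE, the radius below which the noise integral
     vanishes, so [Cnu] is 0. *)
  have sgE : sg = 0 by rewrite /sg /side_exponent alphaE betaE.
  have csE : cs = cMNE^-1 by rewrite /cs /c_side alphaE betaE.
  apply: (uniform 0 _ rho_gt0 _ _ _ noise_ge) => //; rewrite ?sgE//.
  - by rewrite mulr0 subr0 /r /rate_exponent alphaE betaE.
  - rewrite betaE => P eta n n0 eta_post MNE.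
    by rewrite csE oppr0 powRr0 mulr1 mul0r; exact: MNE_infty_near MNE.
have [gamma0|gamma_neq0] := eqVneq gamma 0.
  have noise_ge (P : probability (XY R d) R) (eta : Rd R d -> R) : is_posterior P eta ->
      controls_noise_below P eta gamma cLC -> has_ME P eta alpha cME ->
      {ae marginal P, forall x, cubeX R d x -> cLC^-1 <= `|2 * eta x - 1|}.
    by rewrite gamma0 => _ LC _; exact: LC0_noise_ge LC.
  have cLCV_gt0 : 0 < cLC^-1 by rewrite invr_gt0.
  have [[b [b0 betaE]]|betaE] := real_or_infty _ beta_gt0.
    (* With gamma = 0 the common factor a cancels, and the exponents are those of alpha = oo. *)
    have kE : (1 + gamma) * (a + gamma) = a by rewrite gamma0; ring.
    have FE : b * (a + gamma ^+ 2) + d%:R * a = a * (b + d%:R) by rewrite gamma0; ring.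
    have F0 : 0 < a * (b + d%:R) by rewrite mulr_gt0// dn0.
    have sgE : sg = a / (a * (b + d%:R)) by rewrite /sg /side_exponent alphaE betaE /= kE FE.
    have rE : r = b * a / (a * (b + d%:R)) by rewrite /r /rate_exponent alphaE betaE /= kE FE.
    apply: (uniform ((cMNE * cs) `^ b) _ cLCV_gt0 _ _ _ noise_ge) => //.
    - by rewrite sgE divr_ge0// ltW.
    - by rewrite sgE rE; field; rewrite !gt_eqF// dn0.
    - exact: powR_ge0.
    - rewrite betaE => P eta n n0 _; apply: MNE_fin => //.
      by rewrite sgE rE mulrA.
  have sgE : sg = 0 by rewrite /sg /side_exponent alphaE betaE.
  have csE : cs = cMNE^-1 by rewrite /cs /c_side alphaE betaE.
  apply: (uniform 0 _ cLCV_gt0 _ _ _ noise_ge) => //; rewrite ?sgE//.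
  - rewrite mulr0 subr0 /r /rate_exponent alphaE betaE gamma0 /=.
    by field; rewrite gt_eqF.
  - rewrite betaE => P eta n n0 eta_post MNE.
    by rewrite csE oppr0 powRr0 mulr1 mul0r; exact: MNE_infty_near MNE.
have g0 : 0 < gamma by rewrite lt_neqAle eq_sym gamma_neq0.
(* For gamma > 0 and finite alpha the bound kappa / gamma is finite, so beta is finite and the
   hypothesis reads b gamma <= kappa. *)
move: beta_le; rewrite alphaE /kappa inver (negbTE gamma_neq0) -EFinD -!EFinM.
have [[b [b0 betaE]]|-> //] := real_or_infty _ beta_gt0.
rewrite betaE lee_fin ler_pdivlMl// mulrC => bgk.
have [c [c0 cP]] := @rate_layers R d a b gamma cs cLC cME cMNE tau
  a0 b0 g0 cs0 cLC_gt0 cME_gt0 cMNE_gt0 bgk.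
have sgE : sg = (1 + gamma) * (a + gamma) /
    (b * ((1 + gamma) * (a + gamma) + gamma ^+ 2) + d%:R * ((1 + gamma) * (a + gamma))).
  by rewrite /sg /side_exponent alphaE betaE.
have rE : r = b * ((1 + gamma) * (a + gamma)) /
    (b * ((1 + gamma) * (a + gamma) + gamma ^+ 2) + d%:R * ((1 + gamma) * (a + gamma))).
  by rewrite /r /rate_exponent alphaE betaE.
exists c; split => // X0 _ X0rect; have [n0 n0P] := cP _ X0rect; exists n0.
move=> P eta PX1 eta_post LC MNE ME etaX0 bdpos bdneg n nn0 A.
rewrite -alphaE -betaE sideE sgE rE => Apart.
by apply: le_trans tau_le _; apply: (n0P P eta) => //; rewrite ?etaX0.
Qed.
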